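(* Let $\mathcal H$ be an infinite-dimensional separable complex Hilbert space. For $q\in[1,\infty]$, $T\in\mathcal B^q(\mathcal H)$ and a bounded linear functional $L\in(\mathcal B^q(\mathcal H))'$, let $$L(\mathcal O_U(T)):=\{L(U^\dagger TU)\mid U\in\mathcal B(\mathcal H)\text{ unitary}\}$$ denote the image of the unitary orbit of $T$ under $L$. (a) Let $q\in(1,\infty]$ and $T\in\mathcal B^q(\mathcal H)$. Then for every bounded linear functional $L\in(\mathcal B^q(\mathcal H))'$, the closure of $L(\mathcal O_U(T))$ in $\mathbb C$ is star-shaped with respect to the origin. (b) Let $q=1$ and $T\in\mathcal B^1(\mathcal H)$. Then for every bounded linear functional $L\in(\mathcal B^1(\mathcal H))'$, the closure of $L(\mathcal O_U(T))$ in $\mathbb C$ is star-shaped with respect to $\operatorname{tr}(T)W_e(L)$, i.e. it is star-shaped with respect to every point $z\in\operatorname{tr}(T)W_e(L)=\{\operatorname{tr}(T)w\mid w\in W_e(L)\}$.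
   Context: Notation: $\mathcal B(\mathcal H)$ denotes the bounded linear operators on $\mathcal H$, and $U^\dagger$ denotes the Hilbert space adjoint of $U$. Scalar products are conjugate linear in the first argument and linear in the second. Every compact operator $C$ on $\mathcal H$ has a Schmidt decomposition $C=\sum_{n=1}^\infty s_n(C)\langle f_n,\cdot\rangle g_n$ with orthonormal systems $(f_n)_{n\in\mathbb N}$, $(g_n)_{n\in\mathbb N}$ and a decreasing null sequence $(s_n(C))_{n\in\mathbb N}$ in $[0,\infty)$ of singular numbers, which is uniquely determined by $C$. For $q\in[1,\infty)$, $\mathcal B^q(\mathcal H)$ is the Schatten class of all compact operators $C$ with $\sum_{n=1}^\infty s_n(C)^q<\infty$, a Banach space under $\nu_q(C)=(\sum_{n=1}^\infty s_n(C)^q)^{1/q}$; $\mathcal B^\infty(\mathcal H)$ is the space of all compact operators on $\mathcal H$ with the operator norm $\nu_\infty(C)=s_1(C)=\|C\|$. $(\mathcal B^q(\mathcal H))'$ denotes the dual space of bounded linear functionals on $(\mathcal B^q(\mathcal H),\nu_q)$. The essential range of $L\in(\mathcal B^q(\mathcal H))'$ is $$W_e(L):=\Big\{\lim_{n\to\infty}L(\langle f_n,\cdot\rangle f_n)\ \Big|\ (f_n)_{n\in\mathbb N}\text{ orthonormal system of }\mathcal H\Big\}\subset\mathbb C,$$ i.e. the set of all limits obtained from orthonormal sequences for which the limit exists; here $\langle f_n,\cdot\rangle f_n$ is the rank-one operator $x\mapsto\langle f_n,x\rangle f_n$. A set $S\subseteq\mathbb C$ is star-shaped with respect to $z_0\in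 S$ if $(1-t)z_0+tz\in S$ for all $z\in S$ and $t\in[0,1]$. *)

(* Defs.v *)
From HB Require Import structures.
From mathcomp Require Import all_boot all_order all_algebra.
From mathcomp Require Import all_classical all_reals all_analysis.
From mathcomp Require Import complex sesquilinear.

Set Implicit Arguments.
Unset Strict Implicit.
Unset Printing Implicit Defensive.

Import Order.TTheory GRing.Theory Num.Theory.
Import numFieldNormedType.Exports.

Local Open Scope classical_set_scope.
Local Open Scope complex_scope.
Local Open Scope ring_scope.

(* The topology on R[i] is carried by the regular module R[i]^o, which is
   R[i] seen as a normed space over itself, with the complex modulus as norm. *)

Section StarShaped.
Variable R : realType.

Definition star_shaped (z0 : R[i]^o) (S : set R[i]^o) : Prop :=
  S z0 /\ forall (z : R[i]^o) (t : R), S z -> 0 <= t <= 1 ->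
    S ((1 - t)%:C * z0 + t%:C * z).

End StarShaped.

Section HilbertSpace.
Variables (R : realType) (H : completeNormedModType R[i]).

Definition separable_space : Prop :=
  exists S : set H, countable S /\ dense S.

Definition infinite_dimensional : Prop :=
  forall s : seq H, exists x : H, forall c : nat -> R[i],
    x <> \sum_(i < size s) c i *: s`_i.

Definition bounded_op (A : H -> H) : Prop :=
  linear A /\ exists M : R, forall x, `|A x| <= M%:C * `|x|.

Definition op_norm (A : H -> H) : R :=
  sup [set complex.Re `|A x| | x in [set x : H | `|x| <= 1]].

Definition compact_op (A : H -> H) : Prop :=
  linear A /\ precompact (A @` [set x : H | `|x| <= 1]).

Variable dot : {dot H for Num.conj}.

(* [dot] is linear in its first argument and conjugate linear in its second;
   [braket] follows the opposite convention <x, y>. *)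
Definition braket (x y : H) : R[i]^o := dot y x.

Definition orthonormal_system (f : nat -> H) : Prop :=
  forall i j, braket (f i) (f j) = (i == j)%:R.

Definition orthonormal_basis (e : nat -> H) : Prop :=
  orthonormal_system e /\
  forall x, series (fun n => braket (e n) x *: e n) @ \oo --> x.

Definition is_adjoint (A B : H -> H) : Prop :=
  forall x y, braket (B x) y = braket x (A y).

(* [V] is the adjoint of the unitary operator [U]. *)
Definition unitary_orbit (T : H -> H) : set (H -> H) :=
  [set A | exists U V : H -> H,
     [/\ bounded_op U, bounded_op V, is_adjoint U V,
         V \o U = id /\ U \o V = id & A = V \o T \o U]].

(* Schmidt decomposition A = \sum_n s_n <f_n, .> g_n *)
Definition is_singular_values (A : H -> H) (s : nat -> R) : Prop :=
  [/\ forall n, 0 <= s n,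
      forall m n, (m <= n)%N -> s n <= s m,
      s @ \oo --> (0 : R) &
      exists f g : nat -> H,
        [/\ orthonormal_system f, orthonormal_system g &
            forall x, series (fun n => ((s n)%:C * braket (f n) x) *: g n)
                        @ \oo --> A x]].

(* The sequence [s] above is uniquely determined by [A]. *)
Definition singular_values (A : H -> H) : nat -> R :=
  xget (fun=> 0) (is_singular_values A).

Definition power_sum (r : R) (s : nat -> R) : \bar R :=
  (\sum_(0 <= n <oo) (s n `^ r)%:E)%E.

(* For q = +oo: all compact operators, with the operator norm. Only the
   exponents 1 <= q <= +oo are meaningful. *)
Definition schatten (q : \bar R) : set (H -> H) :=
  [set A | compact_op A /\
    if q is r%:E then
      exists2 s, is_singular_values A s & (power_sum r s < +oo)%E
    else True].

Definition schatten_norm (q : \bar R) (A : H -> H) : R :=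
  if q is r%:E then fine (power_sum r (singular_values A)) `^ r^-1
  else op_norm A.

(* Elements of the dual of the Schatten class are represented by maps on all
   of [H -> H], of which only the restriction to the class matters. *)
Definition schatten_dual (q : \bar R) (L : (H -> H) -> R[i]^o) : Prop :=
  (forall (a : R[i]) (A B : H -> H), schatten q A -> schatten q B ->
     L (a *: A + B) = a * L A + L B) /\
  exists M : R, forall A, schatten q A ->
    `|L A| <= (M * schatten_norm q A)%:C.

Definition essential_range (L : (H -> H) -> R[i]^o) : set R[i]^o :=
  [set w | exists2 f : nat -> H, orthonormal_system f &
     (fun n => L (fun x => braket (f n) x *: f n)) @ \oo --> w].

Definition is_trace (T : H -> H) (t : R[i]^o) : Prop :=
  forall e : nat -> H, orthonormal_basis e ->
    series (fun n => braket (e n) (T (e n))) @ \oo --> t.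

(* The common value of the sums over all orthonormal bases. *)
Definition op_trace (T : H -> H) : R[i]^o := xget 0 (is_trace T).

End HilbertSpace.

(* Main.v *)
Require Import Defs.
From mathcomp Require Import all_boot all_order all_algebra.
From mathcomp Require Import all_classical all_reals all_analysis.
From mathcomp Require Import complex sesquilinear.
From mathcomp Require Import ring lra.
Import Order.TTheory GRing.Theory Num.Theory numFieldNormedType.Exports.
Local Open Scope classical_set_scope.
Local Open Scope complex_scope.
Local Open Scope ring_scope.
Set Implicit Arguments.
Unset Strict Implicit.
Unset Printing Implicit Defensive.

(** Both cases follow from one construction, available because the space is
    infinite-dimensional: any finite-dimensional subspace can be rotated towards
    vectors that are far out along an orthonormal system.

    A functional [L] on a Schatten class is determined on finite-rank operators
    by the form [b x y = L (<x, .> y)], which is sesquilinear and bounded. If [T]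
    is the sum of the [<a j, .> b j] and [V] is the adjoint of the unitary [U],
    then [L (V T U)] is the sum of the [b (V (a j)) (V (b j))]. Let [e] be an
    orthonormal system along which [b (e n) (e n)] clusters at [w]. By Bessel's
    inequality for the functionals [b x .] and [b . x], the values [b x (e n)]
    and [b (e n) x] tend to [0] for fixed [x]. Hence there are orthonormal
    vectors [psi i], orthogonal to an orthonormal basis [phi i] of the span of
    the [a j] and [b j], for which [b (psi i) (psi j)] is nearly [w] if [i = j]
    and [0] otherwise, and which are nearly [b]-orthogonal to that span
    ([far_family]). Let [V] rotate each [phi i] to [c phi i + s (psi i)], where
    [c ^ 2 = t] and [s ^ 2 = 1 - t]. The cross terms are negligible, and
    [L (V T U)] is nearly [t L (T) + (1 - t) w tr T] ([rotate_towards]). Starting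
    from an arbitrary point of the orbit in place of [T], this is the segment
    from that point to [w tr T] ([orbit_segment]).

    A general [T] is replaced by a finite-rank operator, with an error in the
    Schatten norm and therefore uniform over the orbit ([approx_of_remainder]).
    For finite [q] the Schmidt decomposition is truncated; the norm of the
    remainder is known once the singular values are shown to be unique, by a
    min-max argument ([schmidt_le]). For [q = +oo] compactness provides the
    approximation ([compact_approx]).

    It remains to choose [w]. For [q = 1] it is a point of the essential range,
    and the traces of the truncations converge to the trace of [T]
    ([trace_op_trace]). For [q > 1] one can take [w = 0] along every orthonormal
    system: the sum of [n] orthogonal rank-one projections, with weights of
    modulus [1], has norm at most [n ^ (1 / q)], so that [n] diagonal values of
    [b] cannot all exceed a fixed bound when [n] is large
    ([diagonal_cluster0]). *)

(** * Real-valued moduli *)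

Section ComplexModulus.
Variable R : realType.
Implicit Types z w : R[i].

(** The norm of [R[i]] takes its values in [R[i]]; its real part lives in an
    ordered field where linear arithmetic is available. *)
Definition cn z : R := complex.Re `|z|.

Lemma cnE z : (cn z)%:C = `|z|.
Proof. by rewrite /cn RRe_real // normr_real. Qed.

Lemma cn_ge0 z : 0 <= cn z.
Proof. by rewrite -ler0c cnE. Qed.

Lemma cnD z w : cn (z + w) <= cn z + cn w.
Proof. by rewrite -lecR rmorphD /= !cnE ler_normD. Qed.

Lemma cnM z w : cn (z * w) = cn z * cn w.
Proof. by apply: complexI; rewrite rmorphM /= !cnE normrM. Qed.

Lemma cn0 : cn 0 = 0.
Proof. by rewrite /cn normr0. Qed.

Lemma cn1 : cn 1 = 1.
Proof. by rewrite /cn normr1. Qed.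

Lemma cnN z : cn (- z) = cn z.
Proof. by rewrite /cn normrN. Qed.

Lemma cnBC z w : cn (z - w) = cn (w - z).
Proof. by rewrite -cnN opprB. Qed.

Lemma cnJ z : cn z^* = cn z.
Proof. by rewrite /cn norm_conjC. Qed.

Lemma cnR (x : R) : 0 <= x -> cn x%:C = x.
Proof. by move=> x0; apply: complexI; rewrite cnE ger0_norm // ler0c. Qed.

Lemma cn_eq0 z : cn z = 0 -> z = 0.
Proof.
by move=> z0; apply/eqP; rewrite -normr_eq0 -cnE z0.
Qed.

Lemma cnK z : z^* * z = (cn z ^+ 2)%:C.
Proof. by rewrite mulrC -normCK rmorphXn /= cnE. Qed.

Lemma cn_triangle w z v : cn (z - v) <= cn (z - w) + cn (w - v).
Proof. by rewrite (_ : z - v = (z - w) + (w - v)) ?cnD // addrA subrK. Qed.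

Lemma cn_sum (I : Type) (r : seq I) (P : pred I) (F : I -> R[i]) :
  cn (\sum_(i <- r | P i) F i) <= \sum_(i <- r | P i) cn (F i).
Proof.
elim/big_rec2: _ => [|i y x _ h]; first by rewrite cn0.
exact: le_trans (cnD _ _) (lerD _ h).
Qed.

Lemma conjR (x : R) : (x%:C : R[i])^* = x%:C.
Proof. exact: conjc_real. Qed.

Lemma Re_le_cn z : complex.Re z <= cn z.
Proof.
by rewrite -lecR cnE; apply: le_trans (normc_ge_Re z); rewrite lecR ler_norm.
Qed.

End ComplexModulus.

(** * Inner product geometry *)

Section InnerProduct.
Variables (R : realType) (H : lmodType R[i]) (dot : {dot H for Num.conj}).
Implicit Types (x y z : H) (a : R[i]) (n m : nat).

Definition ip x y : R[i] := dot y x.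

Lemma ipC x y : ip x y = (ip y x)^*.
Proof. by rewrite /ip hermC /= expr0 mul1r. Qed.

Lemma ipDr x y z : ip x (y + z) = ip x y + ip x z.
Proof. exact: linearDl. Qed.

Lemma ipDl x y z : ip (x + y) z = ip x z + ip y z.
Proof. exact: linearDr. Qed.

Lemma ipZr x a y : ip x (a *: y) = a * ip x y.
Proof. exact: linearZl_LR. Qed.

Lemma ipZl a x y : ip (a *: x) y = a^* * ip x y.
Proof. exact: linearZr_LR. Qed.

Lemma ip0r x : ip x 0 = 0.
Proof. exact: linear0l. Qed.

Lemma ip0l x : ip 0 x = 0.
Proof. exact: linear0r. Qed.

Lemma ipNr x y : ip x (- y) = - ip x y.
Proof. exact: linearNl. Qed.

Lemma ipNl x y : ip (- x) y = - ip x y.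
Proof. exact: linearNr. Qed.

Lemma ipBr x y z : ip x (y - z) = ip x y - ip x z.
Proof. by rewrite ipDr ipNr. Qed.

Lemma ipBl x y z : ip (x - y) z = ip x z - ip y z.
Proof. by rewrite ipDl ipNl. Qed.

Lemma ip_sumr (I : Type) (r : seq I) (P : pred I) (F : I -> H) x :
  ip x (\sum_(i <- r | P i) F i) = \sum_(i <- r | P i) ip x (F i).
Proof.
by elim/big_rec2: _ => [|i y1 y2 _ <-]; [rewrite ip0r|rewrite ipDr].
Qed.

Lemma ip_suml (I : Type) (r : seq I) (P : pred I) (F : I -> H) x :
  ip (\sum_(i <- r | P i) F i) x = \sum_(i <- r | P i) ip (F i) x.
Proof.
by elim/big_rec2: _ => [|i y1 y2 _ <-]; [rewrite ip0l|rewrite ipDl].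
Qed.

Lemma ip_ge0 x : 0 <= ip x x.
Proof. exact: (dnorm_ge0 dot). Qed.

(** The norm as an element of the ordered field; [normE] relates it to the norm of
    the Hilbert space. *)
Definition hn x : R := Num.sqrt (complex.Re (ip x x)).

Lemma hn_ge0 x : 0 <= hn x.
Proof. exact: sqrtr_ge0. Qed.

Lemma hn2 x : hn x ^+ 2 = complex.Re (ip x x).
Proof. by rewrite sqr_sqrtr //; have := ip_ge0 x; rewrite lecE => /andP[]. Qed.

Lemma ipxx x : ip x x = (hn x ^+ 2)%:C.
Proof. by rewrite hn2 RRe_real // ger0_real // ip_ge0. Qed.

Lemma hn0 : hn 0 = 0.
Proof. by rewrite /hn ip0r /= sqrtr0. Qed.

Lemma hn_eq0 x : hn x = 0 -> x = 0.
Proof.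
move=> x0; apply/eqP; rewrite -(dnorm_eq0 dot).
by rewrite (ipxx x : dot x x = _) x0 expr0n.
Qed.

Lemma hn_eqP x y : complex.Re (ip x x) = complex.Re (ip y y) -> hn x = hn y.
Proof. by rewrite /hn => ->. Qed.

Lemma hnZ a x : hn (a *: x) = cn a * hn x.
Proof.
apply/eqP; rewrite -(@eqrXn2 _ 2) ?mulr_ge0 ?cn_ge0 ?hn_ge0 //; apply/eqP.
apply: complexI; rewrite -ipxx ipZr ipZl mulrA (mulrC a) cnK ipxx exprMn.
by rewrite -rmorphM.
Qed.

Lemma hnN x : hn (- x) = hn x.
Proof. by rewrite -scaleN1r hnZ cnN cn1 mul1r. Qed.

Lemma hnBC x y : hn (x - y) = hn (y - x).
Proof. by rewrite -hnN opprB. Qed.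

Lemma cauchy_schwarz x y : cn (ip x y) <= hn x * hn y.
Proof.
have [->|y0] := eqVneq y 0; first by rewrite ip0r cn0 hn0 mulr0.
have hy : 0 < hn y.
  by rewrite lt0r hn_ge0 andbT; apply: contra_neq y0; exact: hn_eq0.
pose c := ip y x; pose q := hn y ^+ 2.
have q0 : q != 0 by rewrite /q expf_neq0 // gt_eqF.
(* the residual of [x] after projection on the line of [y] *)
have := ip_ge0 (x - (c / q%:C) *: y).
have e : ip x y = c^* by rewrite /c -ipC.
have kJ : (c / q%:C)^* = c^* / q%:C.
  by rewrite rmorphM fmorphV /= conjR.
have qC : q%:C != 0 by rewrite -(inj_eq (@complexI R)) in q0.
rewrite ipBr !ipBl !ipZr !ipZl -/c e !ipxx -/q kJ.
have -> : (hn x ^+ 2)%:C - c^* / q%:C * c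
     - (c / q%:C * c^* - c / q%:C * (c^* / q%:C * q%:C))
   = (hn x ^+ 2 - cn c ^+ 2 / q)%:C.
  rewrite (rmorphB (real_complex R)) (rmorphM _ (cn c ^+ 2)) fmorphV /= -(cnK c).
  by field.
rewrite ler0c subr_ge0 ler_pdivrMr ?exprn_gt0 // -exprMn.
by rewrite ler_pXn2r ?nnegrE ?mulr_ge0 ?cn_ge0 ?hn_ge0 // cnJ.
Qed.

Lemma hnD x y : hn (x + y) <= hn x + hn y.
Proof.
rewrite -(@ler_pXn2r _ 2) ?nnegrE ?addr_ge0 ?hn_ge0 //.
rewrite hn2 ipDr !ipDl !raddfD /= -!hn2 sqrrD.
have h1 := le_trans (Re_le_cn _) (cauchy_schwarz x y).
have h2 := le_trans (Re_le_cn _) (cauchy_schwarz y x).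
lra.
Qed.

Lemma hnB x y : hn (x - y) <= hn x + hn y.
Proof. by rewrite -(hnN y) hnD. Qed.

Lemma hn_sum (I : Type) (r : seq I) (P : pred I) (F : I -> H) :
  hn (\sum_(i <- r | P i) F i) <= \sum_(i <- r | P i) hn (F i).
Proof.
elim/big_rec2: _ => [|i y x _ h]; first by rewrite hn0.
exact: le_trans (hnD _ _) (lerD _ h).
Qed.

(** * Finite orthonormal families *)

(** Finite families are indexed by [nat], with their length apart, so that a
    family and its extensions have the same type. *)
Definition ons (f : nat -> H) n :=
  forall i j, (i < n)%N -> (j < n)%N -> ip (f i) (f j) = (i == j)%:R.

Lemma ons_le f n m : (m <= n)%N -> ons f n -> ons f m.
Proof.
by move=> mn of_ i j im jm; apply: of_; [exact: leq_trans mn|exact: leq_trans mn].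
Qed.

Lemma eq_ons f g n : (forall i, (i < n)%N -> f i = g i) -> ons f n -> ons g n.
Proof. by move=> fg of_ i j ni nj; rewrite -!fg // of_. Qed.

Lemma hn1P x : ip x x = 1 -> hn x = 1.
Proof. by rewrite /hn => ->; rewrite /= sqrtr1. Qed.

Lemma ons_hn f n i : ons f n -> (i < n)%N -> hn (f i) = 1.
Proof. by move=> of_ ni; apply: hn1P; rewrite of_ // eqxx. Qed.

Lemma ip_onsr f n j (a : nat -> R[i]) : ons f n -> (j < n)%N ->
  ip (f j) (\sum_(i < n) a i *: f i) = a j.
Proof.
move=> of_ nj; rewrite ip_sumr (bigD1 (Ordinal nj)) //= ipZr of_ // eqxx mulr1.
rewrite big1 ?addr0 // => i ij; rewrite ipZr of_ //.
by rewrite (_ : (j == i) = false) ?mulr0 // eq_sym; apply: negbTE.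
Qed.

Lemma ip_ons f n (a b : nat -> R[i]) : ons f n ->
  ip (\sum_(i < n) a i *: f i) (\sum_(i < n) b i *: f i)
    = \sum_(i < n) (a i)^* * b i.
Proof.
by move=> of_; rewrite ip_suml; apply: eq_bigr => i _; rewrite ipZl ip_onsr.
Qed.

Lemma hn2_ons f n (a : nat -> R[i]) : ons f n ->
  hn (\sum_(i < n) a i *: f i) ^+ 2 = \sum_(i < n) cn (a i) ^+ 2.
Proof.
move=> of_; apply: complexI; rewrite -ipxx ip_ons // rmorph_sum /=.
by apply: eq_bigr => i _; rewrite cnK.
Qed.

Definition proj (f : nat -> H) n x := \sum_(i < n) ip (f i) x *: f i.

Lemma proj_linear f n : linear (proj f n).
Proof.
move=> a x y; rewrite /proj scaler_sumr -big_split /=; apply: eq_bigr => i _.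
by rewrite ipDr ipZr scalerDl scalerA.
Qed.

Lemma projB f n x y : proj f n (x - y) = proj f n x - proj f n y.
Proof.
by rewrite addrC -scaleN1r proj_linear scaleN1r addrC.
Qed.

Lemma ip_proj f n j x : ons f n -> (j < n)%N -> ip (f j) (proj f n x) = ip (f j) x.
Proof. by move=> of_ nj; rewrite /proj (ip_onsr (fun i => ip (f i) x)). Qed.

Lemma proj_ons f n j : ons f n -> (j < n)%N -> proj f n (f j) = f j.
Proof.
move=> of_ nj; rewrite /proj (bigD1 (Ordinal nj)) //= of_ // eqxx scale1r.
rewrite big1 ?addr0 // => i ij; rewrite of_ //.
by rewrite (_ : (_ == j) = false) ?scale0r //; apply: negbTE.
Qed.

Lemma ip_resid f n j x : ons f n -> (j < n)%N -> ip (f j) (x - proj f n x) = 0.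
Proof. by move=> of_ nj; rewrite ipBr ip_proj // subrr. Qed.

Lemma pythagoras f n x : ons f n ->
  hn x ^+ 2 = hn (x - proj f n x) ^+ 2 + hn (proj f n x) ^+ 2.
Proof.
move=> of_; set p := proj f n x; set r := x - p.
have pr0 : ip p r = 0.
  rewrite /p /proj ip_suml big1 // => i _; rewrite ipZl ip_resid ?mulr0 //.
have rp0 : ip r p = 0 by rewrite ipC pr0 rmorph0.
have xE : x = r + p by rewrite subrK.
clearbody r; clearbody p; rewrite xE.
apply: complexI; rewrite -ipxx ipDr !ipDl pr0 rp0 addr0 add0r !ipxx.
by rewrite rmorphD.
Qed.

Lemma hn2_proj f n x : ons f n ->
  hn (proj f n x) ^+ 2 = \sum_(i < n) cn (ip (f i) x) ^+ 2.
Proof. by move=> of_; rewrite /proj (hn2_ons (fun i => ip (f i) x)). Qed.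

Lemma bessel f n x : ons f n -> \sum_(i < n) cn (ip (f i) x) ^+ 2 <= hn x ^+ 2.
Proof.
by move=> of_; rewrite -hn2_proj // (pythagoras x of_) lerDr exprn_ge0 ?hn_ge0.
Qed.

Lemma hn_resid_le f n x : ons f n -> hn (x - proj f n x) <= hn x.
Proof.
move=> of_; rewrite -(@ler_pXn2r _ 2) ?nnegrE ?hn_ge0 // (pythagoras x of_).
by rewrite lerDl exprn_ge0 ?hn_ge0.
Qed.

Lemma proj_approx f n x d : ons f n -> proj f n d = d ->
  hn (x - proj f n x) <= hn (x - d).
Proof.
move=> of_ pd; rewrite (_ : x - proj f n x = x - d - proj f n (x - d)).
  exact: hn_resid_le.
by rewrite projB pd opprB addrA subrK.
Qed.

Lemma proj_le f n m x : ons f m -> (n <= m)%N -> proj f n x = x -> proj f m x = x.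
Proof.
move=> of_ nm px; apply/esym/eqP; rewrite -subr_eq0; apply/eqP/hn_eq0.
apply/eqP; rewrite eq_le hn_ge0 andbT -hn0 -(subrr x).
apply: proj_approx => //; rewrite -[in RHS]px -[in LHS]px.
rewrite {1}/proj; under eq_bigr => i _ do rewrite /proj.
rewrite /proj; under eq_bigr => i _ do rewrite ip_sumr scaler_suml.
rewrite exchange_big /=; apply: eq_bigr => i _.
under eq_bigr => j _ do rewrite ipZr -scalerA.
rewrite -scaler_sumr; congr (_ *: _).
exact: (@proj_ons f m i of_ (leq_trans (ltn_ord i) nm)).
Qed.

(** Replacing the coefficients of [x] and [y] by their moduli does not increase
    the norms, by Bessel's inequality; the sum is then an inner product, to
    which Cauchy--Schwarz applies. *)
Lemma bessel2 f n x y : ons f n ->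
  \sum_(i < n) cn (ip x (f i) * ip (f i) y) <= hn x * hn y.
Proof.
move=> of_; pose u i : R := cn (ip (f i) x); pose v i : R := cn (ip (f i) y).
have -> : \sum_(i < n) cn (ip x (f i) * ip (f i) y) = \sum_(i < n) u i * v i.
  by apply: eq_bigr => i _; rewrite cnM ipC cnJ.
pose X := \sum_(i < n) (u i)%:C *: f i; pose Y := \sum_(i < n) (v i)%:C *: f i.
have e : \sum_(i < n) u i * v i = cn (ip X Y).
  rewrite /X /Y (ip_ons (fun i => (u i)%:C) (fun i => (v i)%:C) of_).
  rewrite (_ : \sum_(i < n) _ = (\sum_(i < n) u i * v i)%:C); last first.
    by rewrite rmorph_sum; apply: eq_bigr => i _; rewrite conjR rmorphM.
  by rewrite cnR // sumr_ge0 // => i _; rewrite mulr_ge0 ?cn_ge0.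
have le w (W := \sum_(i < n) (cn (ip (f i) w))%:C *: f i) : hn W <= hn w.
  rewrite -(@ler_pXn2r _ 2) ?nnegrE ?hn_ge0 //.
  rewrite /W (hn2_ons (fun i => (cn (ip (f i) w))%:C) of_).
  under eq_bigr => i _ do rewrite cnR ?cn_ge0 //.
  exact: bessel.
rewrite e; apply: le_trans (cauchy_schwarz _ _) _.
by apply: ler_pM; rewrite ?hn_ge0 // le.
Qed.

End InnerProduct.

(** * Limits through real moduli *)

Section Limits.
Variables (R : realType) (H : completeNormedModType R[i]).
Variables (dot : {dot H for Num.conj}).
Hypothesis norm_dot : forall x : H, `|x| ^+ 2 = dot x x.
Local Notation ip := (ip dot).
Local Notation hn := (hn dot).

Lemma normE (x : H) : `|x| = (hn x)%:C.
Proof.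
apply/eqP; rewrite -(@eqrXn2 _ 2) ?ler0c ?hn_ge0 //; apply/eqP.
by rewrite norm_dot -(rmorphXn (real_complex R)) /= -ipxx.
Qed.

Lemma cvg_hnP (u : nat -> H) (l : H) :
  u @ \oo --> l <->
  (forall e : R, 0 < e -> \forall n \near \oo, hn (l - u n) < e).
Proof.
split=> [/cvgrPdist_lt h e e0|h].
  have /h : 0 < e%:C by rewrite ltcR.
  by apply: filterS => n; rewrite normE ltcR.
apply/cvgrPdist_lt => e e0; have eE : e = (complex.Re e)%:C.
  by rewrite RRe_real // gtr0_real.
have /h : 0 < complex.Re e by rewrite -ltcR -eE.
by apply: filterS => n hne; rewrite eE normE ltcR.
Qed.

Lemma cvg_cnP (u : nat -> R[i]^o) (l : R[i]^o) :
  u @ \oo --> l <->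
  (forall e : R, 0 < e -> \forall n \near \oo, cn (l - u n) < e).
Proof.
split=> [/cvgrPdist_lt h e e0|h].
  have /h : 0 < e%:C by rewrite ltcR.
  by apply: filterS => n; rewrite -[X in X < _]cnE ltcR.
apply/cvgrPdist_lt => e e0; have eE : e = (complex.Re e)%:C.
  by rewrite RRe_real // gtr0_real.
have /h : 0 < complex.Re e by rewrite -ltcR -eE.
by apply: filterS => n hne; rewrite eE -[X in X < _]cnE ltcR.
Qed.

Lemma cvg_ipr (u : nat -> H) (l x : H) :
  u @ \oo --> l -> (fun n => ip x (u n) : R[i]^o) @ \oo --> (ip x l : R[i]^o).
Proof.
move=> /cvg_hnP h; apply/cvg_cnP => e e0.
have h1 : 0 < hn x + 1 by rewrite ltr_wpDl ?hn_ge0.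
have /h : 0 < e / (hn x + 1) by rewrite divr_gt0.
apply: filterS => n hne; rewrite -ipBr.
apply: le_lt_trans (cauchy_schwarz _ _ _) _.
apply: le_lt_trans (_ : (hn x + 1) * hn (l - u n) < e); last first.
  by rewrite mulrC -ltr_pdivlMr.
by rewrite ler_wpM2r ?hn_ge0 // lerDl.
Qed.

Lemma hn_cvg_le (u : nat -> H) (l : H) (B : R) :
  u @ \oo --> l -> (\forall n \near \oo, hn (u n) <= B) -> hn l <= B.
Proof.
move=> /cvg_hnP h hB; apply/ler_addgt0Pr => e e0.
have [n [uB ue]] := filter_ex (filterI hB (h e e0)).
rewrite (_ : l = u n + (l - u n)); last by rewrite addrC subrK.
by apply: le_trans (hnD _ _ _) _; rewrite lerD // ltW.
Qed.

Lemma cn_cvg_le (u : nat -> R[i]^o) (l : R[i]^o) (B : R) :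
  u @ \oo --> l -> (\forall n \near \oo, cn (u n) <= B) -> cn l <= B.
Proof.
move=> /cvg_cnP h hB; apply/ler_addgt0Pr => e e0.
have [n [uB ue]] := filter_ex (filterI hB (h e e0)).
rewrite (_ : l = u n + (l - u n)); last by rewrite addrC subrK.
by apply: le_trans (cnD _ _) _; rewrite lerD // ltW.
Qed.

(** Nonnegative terms with bounded partial sums have small tails: the partial
    sums come within [e] of their supremum. *)
Lemma small_tail (u : nat -> R) (B : R) : (forall i, 0 <= u i) ->
  (forall n, \sum_(i < n) u i <= B) ->
  forall e, 0 < e -> exists N, forall n, \sum_(N <= i < n) u i <= e.
Proof.
move=> u0 uB e e0; pose S := [set \sum_(i < n) u i | n in [set: nat]].
have hS : has_sup S.
  by split; [exists (\sum_(i < 0) u i), 0%N|exists B => _ [n _ <-]].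
have [_ [N _ <-] hN] := sup_adherent e0 hS; exists N => n.
have [nN|Nn] := leqP n N; first by rewrite big_geq // ltW.
have : \sum_(i < n) u i <= sup S by apply: sup_upper_bound => //; exists n.
rewrite -(big_mkord xpredT) (@big_cat_nat _ _ _ N 0 n) ?(ltnW Nn) //= big_mkord.
by move: hN; lra.
Qed.

End Limits.

(** * Gram--Schmidt and orthonormal bases *)

Section GramSchmidt.
Variables (R : realType) (H : lmodType R[i]) (dot : {dot H for Num.conj}).
Local Notation ip := (ip dot).
Local Notation hn := (hn dot).
Local Notation ons := (ons dot).
Local Notation proj := (proj dot).

Lemma eq_proj f g n x : (forall i, (i < n)%N -> f i = g i) ->
  proj f n x = proj g n x.
Proof. by move=> fg; apply: eq_bigr => i _; rewrite fg. Qed.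

Lemma projS f n x : proj f n.+1 x = proj f n x + ip (f n) x *: f n.
Proof. by rewrite /proj big_ord_recr. Qed.

Definition extend (f : nat -> H) n v : nat -> H :=
  fun i => if (i < n)%N then f i else v.

Lemma extendl f n v i : (i < n)%N -> extend f n v i = f i.
Proof. by rewrite /extend => ->. Qed.

Lemma extendr f n v : extend f n v n = v.
Proof. by rewrite /extend ltnn. Qed.

Lemma ons_extend f n v : ons f n -> hn v = 1 ->
  (forall i, (i < n)%N -> ip (f i) v = 0) -> ons (extend f n v) n.+1.
Proof.
move=> of_ v1 fv i j; rewrite !ltnS (leq_eqVlt i) (leq_eqVlt j).
have vv : ip v v = 1 by rewrite ipxx v1 expr1n.
move=> /orP[/eqP->|ni] /orP[/eqP->|nj]; 
  rewrite ?extendr ?(extendl _ _ ni) ?(extendl _ _ nj).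
- by rewrite eqxx.
- by rewrite ipC fv // rmorph0 gtn_eqF.
- by rewrite fv // ltn_eqF.
- exact: of_.
Qed.

(** The Gram--Schmidt step: [v] is the normalised residual of [x]. *)
Lemma unit_resid f n x : ons f n -> proj f n x <> x ->
  exists v, [/\ hn v = 1, forall i, (i < n)%N -> ip (f i) v = 0 &
    proj (extend f n v) n.+1 x = x].
Proof.
move=> of_ px; pose r := x - proj f n x.
have r0 : hn r != 0.
  by apply/eqP => /hn_eq0/eqP; rewrite subr_eq0 => /eqP xe; apply: px.
pose k : R[i] := (hn r)^-1%:C.
have ck : cn k = (hn r)^-1 by rewrite cnR // invr_ge0 hn_ge0.
have v1 : hn (k *: r) = 1 by rewrite hnZ ck mulVf.
have fv i : (i < n)%N -> ip (f i) (k *: r) = 0.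
  by move=> ni; rewrite ipZr ip_resid // mulr0.
exists (k *: r); split=> //.
rewrite projS extendr (@eq_proj _ f); last by move=> i ni; rewrite extendl.
suff -> : ip (k *: r) x *: (k *: r) = r by rewrite addrC subrK.
have rp : ip (k *: r) (proj f n x) = 0.
  rewrite /proj ip_sumr big1 // => i _.
  by rewrite ipZr (ipC _ (k *: r)) fv // rmorph0 mulr0.
have -> : ip (k *: r) x = ip (k *: r) r by rewrite [in RHS]ipBr rp subr0.
rewrite ipZl ipxx conjR scalerA -[RHS]scale1r; congr (_ *: _).
rewrite -!rmorphM /= -(rmorph1 (real_complex R)); congr (_%:C).
by field.
Qed.

(** The captured vectors are those fixed by the projection: this expresses
    membership in the span without coefficients. *)
Lemma capture (X : seq H) : exists f n, ons f n /\
  forall x, x \in X -> proj f n x = x.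
Proof.
elim: X => [|x X [f [n [of_ fX]]]]; first by exists (fun=> 0), 0%N; split.
have [px|/eqP px] := eqVneq (proj f n x) x.
  by exists f, n; split=> // y; rewrite inE => /predU1P[->|/fX].
have [v [v1 fv xv]] := unit_resid of_ px.
have og := ons_extend of_ v1 fv.
exists (extend f n v), n.+1; split=> // y; rewrite inE => /predU1P[->//|/fX yX].
apply: proj_le (og) (leqnSn n) _; rewrite (@eq_proj _ f) //.
by move=> i ni; rewrite extendl.
Qed.

End GramSchmidt.

Section Basis.
Variables (R : realType) (H : completeNormedModType R[i]).
Variables (dot : {dot H for Num.conj}).
Hypothesis norm_dot : forall x : H, `|x| ^+ 2 = dot x x.
Hypothesis Hinf : infinite_dimensional H.
Local Notation ip := (ip dot).
Local Notation hn := (hn dot).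
Local Notation ons := (ons dot).
Local Notation proj := (proj dot).

Lemma orthonormal_systemP (f : nat -> H) :
  orthonormal_system dot f <-> forall n, ons f n.
Proof.
split=> [of_ n i j _ _|of_ i j]; first exact: of_.
by apply: (of_ (maxn i j).+1); rewrite ltnS ?leq_maxl ?leq_maxr.
Qed.

Lemma fresh f n : ons f n ->
  exists v, hn v = 1 /\ forall i, (i < n)%N -> ip (f i) v = 0.
Proof.
move=> of_; have [x xs] := Hinf (mkseq f n).
have px : proj f n x <> x.
  move=> px; apply: (xs (fun i => ip (f i) x)); rewrite size_mkseq -[LHS]px.
  by apply: eq_bigr => i _; rewrite nth_mkseq.
by have [v [v1 fv _]] := unit_resid of_ px; exists v.
Qed.

(** At stage [i] the new vector is the normalised residual of [d i], or any fresh
    unit vector when that residual vanishes. *)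
Lemma extend_system (d : nat -> H) f n : ons f n ->
  exists e, [/\ orthonormal_system dot e, forall i, (i < n)%N -> e i = f i &
    forall i, proj e (n + i).+1 (d i) = d i].
Proof.
move=> of_.
have step (gk : (nat -> H) * nat) : exists v, ons gk.1 (n + gk.2) ->
    ons (extend gk.1 (n + gk.2) v) (n + gk.2).+1 /\
    proj (extend gk.1 (n + gk.2) v) (n + gk.2).+1 (d gk.2) = d gk.2.
  case: gk => g k /=.
  have [og|nog] := pselect (ons g (n + k)); last by exists 0.
  have [pd|/eqP pd] := eqVneq (proj g (n + k) (d k)) (d k).
    have [v [v1 gv]] := fresh og; exists v => _.
    have oe := ons_extend og v1 gv; split=> //.
    apply: proj_le (oe) (leqnSn _) _; rewrite (@eq_proj _ _ _ _ g) //.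
    by move=> i ni; rewrite extendl.
  have [v [v1 gv xv]] := unit_resid og pd; exists v => _.
  by split=> //; apply: ons_extend.
have [pick pickP] := choice step.
pose g := fix g k := if k is k'.+1 then extend (g k') (n + k') (pick (g k', k'))
                     else f.
have og k : ons (g k) (n + k).
  elim: k => [|k IH] /=; first by rewrite addn0.
  by rewrite addnS; have [] := pickP (g k, k) IH.
have gle i k l : (k <= l)%N -> (i < n + k)%N -> g l i = g k i.
  elim: l => [|l IH]; first by rewrite leqn0 => /eqP ->.
  rewrite leq_eqVlt => /predU1P[->//|]; rewrite ltnS => kl ik /=.
  by rewrite extendl ?IH // (leq_trans ik) // leq_add2l.
pose e i := g i.+1 i.
have ge i k : (i < n + k)%N -> g k i = e i.
  move=> ik; rewrite /e; have [ki|ki] := leqP k i.+1.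
    by rewrite (@gle i k i.+1).
  by rewrite (@gle i i.+1 k) ?(ltnW ki) // addnS ltnS leq_addl.
exists e; split.
- apply/orthonormal_systemP => k; apply: (@ons_le _ _ _ _ (n + k)); first exact: leq_addl.
  by apply: eq_ons (og k) => i; exact: ge.
- by move=> i ni; rewrite -(ge i 0%N) ?addn0.
- move=> i; have [_] := pickP (g i, i) (og i); rewrite -/(g i.+1) => gd.
  rewrite -[RHS]gd; apply: eq_proj => j jn.
  by rewrite (ge j i.+1) // addnS.
Qed.

(** A basis adapted to a dense sequence: the projections of [x] are at least
    as good as any captured approximation. *)
Lemma exists_basis : separable_space H -> exists e, orthonormal_basis dot e.
Proof.
move=> [S [/countable_injP[h hinj] Sd]].
pose d k := xget 0 [set x | S x /\ h x = k].
have dS x : S x -> d (h x) = x.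
  move=> Sx; rewrite /d; case: xgetP => [y _ [Sy hy]|/(_ x)]; last by case.
  by apply: hinj; rewrite ?inE.
have [e [oe _ ed]] := @extend_system d (fun=> 0) 0 (fun i j => ltac:(by [])).
exists e; split=> // x; apply/(cvg_hnP norm_dot) => r r0.
have [y [xy Sy]] : (ball x r%:C `&` S) !=set0.
  apply: Sd; first by exists x; apply: ballxx; rewrite ltcR.
  by apply: ball_open; rewrite ltcR.
near=> n; rewrite /series /= big_mkord.
have oen : ons e n by have /orthonormal_systemP := oe; apply.
have pn : hn (x - proj e n x) <= hn (x - y).
  apply: proj_approx => //; rewrite -(dS _ Sy); apply: proj_le (oen) _ (ed _).
  by near: n; exact: nbhs_infty_ge.
apply: le_lt_trans pn _.
by move: xy; rewrite -ball_normE /ball_ /= (normE norm_dot) ltcR.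
Unshelve. all: by end_near. Qed.

End Basis.

(** * Bounded functionals and forms along orthonormal systems *)

Lemma near_seq (T : eqType) (X : seq T) (P : T -> nat -> Prop) :
  (forall x, x \in X -> \forall n \near \oo, P x n) ->
  \forall n \near \oo, forall x, x \in X -> P x n.
Proof.
elim: X => [|y X IH] h; first by apply: nearW => n x; rewrite in_nil.
have h1 : \forall n \near \oo, P y n by apply: h; rewrite mem_head.
have h2 : \forall n \near \oo, forall x, x \in X -> P x n.
  by apply: IH => x xX; apply: h; rewrite inE xX orbT.
apply: filterS2 h1 h2 => n Py PX x; rewrite inE => /predU1P[->//|]; exact: PX.
Qed.

Section Forms.
Variables (R : realType) (H : lmodType R[i]) (dot : {dot H for Num.conj}).
Local Notation ip := (ip dot).
Local Notation hn := (hn dot).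
Local Notation ons := (ons dot).
Local Notation proj := (proj dot).

Section Functional.
Variables (l : H -> R[i]) (C : R).
Hypotheses (llin : forall a x y, l (a *: x + y) = a * l x + l y)
  (lC : forall x, cn (l x) <= C * hn x).

Lemma functional_sum n (a : nat -> R[i]) (f : nat -> H) :
  l (\sum_(i < n) a i *: f i) = \sum_(i < n) a i * l (f i).
Proof.
elim: n => [|n IH]; last by rewrite !big_ord_recr /= addrC llin IH addrC.
rewrite !big_ord0; apply: cn_eq0; apply/eqP.
by rewrite eq_le cn_ge0 andbT; apply: le_trans (lC 0) _; rewrite hn0 mulr0.
Qed.

(** Bessel's inequality for a functional that need not be an inner product:
    test it on the combination with conjugate coefficients. *)
Lemma functional_bessel f n : ons f n ->
  \sum_(i < n) cn (l (f i)) ^+ 2 <= C ^+ 2.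
Proof.
move=> of_; set S := \sum_(i < n) _.
pose y := \sum_(i < n) (l (f i))^* *: f i.
have hy : hn y ^+ 2 = S.
  rewrite /y (hn2_ons (fun i => (l (f i))^*) of_).
  by apply: eq_bigr => i _; rewrite cnJ.
have S0 : 0 <= S by rewrite -hy exprn_ge0 ?hn_ge0.
have ly : cn (l y) = S.
  rewrite /y (functional_sum n (fun i => (l (f i))^*)) -[RHS]cnR //; congr cn.
  by rewrite /S rmorph_sum; apply: eq_bigr => i _; rewrite cnK.
have := lC y; rewrite ly -{1}hy expr2 => h.
have [y0|y0] := eqVneq (hn y) 0; first by rewrite -hy y0 expr0n sqr_ge0.
have yp : 0 < hn y by rewrite lt_def y0 hn_ge0.
move: h; rewrite ler_pM2r // => yC.
by rewrite -hy ler_pXn2r ?nnegrE ?hn_ge0 // (le_trans (ltW yp)).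
Qed.

Lemma functional_decay e : (forall n, ons e n) ->
  forall r, 0 < r -> \forall n \near \oo, cn (l (e n)) <= r.
Proof.
move=> oe r r0.
have [//|||N hN] := @small_tail _ (fun i => cn (l (e i)) ^+ 2) (C ^+ 2) _ _ (r ^+ 2).
- by move=> i; rewrite sqr_ge0.
- by move=> n; apply: functional_bessel.
- by rewrite exprn_gt0.
near=> n; have Nn : (N <= n)%N by near: n; exact: nbhs_infty_ge.
rewrite -(@ler_pXn2r _ 2) ?nnegrE ?cn_ge0 ?(ltW r0) //.
apply: le_trans (hN n.+1); rewrite big_nat_recr //= lerDr.
by rewrite sumr_ge0 // => i _; rewrite sqr_ge0.
Unshelve. all: by end_near. Qed.

End Functional.

Definition bounded_form (b : H -> H -> R[i]) (K : R) :=
  [/\ 0 <= K,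
      forall x a y z, b x (a *: y + z) = a * b x y + b x z,
      forall x a y z, b (a *: y + z) x = a^* * b y x + b z x &
      forall x y, cn (b x y) <= K * hn x * hn y].

(** An almost orthogonal unit vector is close to an orthogonal one: its residual
    [r] lies within [p] of [e], and normalising [r] moves it by [1 - |r| <= |p|]. *)
Lemma unit_near f n e : ons f n -> hn e = 1 -> hn (proj f n e) < 1 ->
  exists v, [/\ hn v = 1, forall i, (i < n)%N -> ip (f i) v = 0 &
    hn (v - e) <= 2 * hn (proj f n e)].
Proof.
move=> of_ e1 pe; set p := proj f n e in pe *; pose r := e - p.
have r1 : hn r <= 1 by rewrite -e1; apply: hn_resid_le.
have r2 : 1 <= hn r + hn p by rewrite -e1 -{1}(subrK p e) hnD.
have rp : 0 < hn r by move: r2 pe; lra.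
pose k : R := (hn r)^-1; have k0 : 0 <= k by rewrite invr_ge0 hn_ge0.
have k1 : 1 <= k by rewrite invf_ge1.
exists (k%:C *: r); split.
- by rewrite hnZ cnR // mulVf // gt_eqF.
- by move=> i ni; rewrite ipZr ip_resid // mulr0.
- rewrite (_ : _ - e = (k - 1)%:C *: r - p); last first.
    rewrite (rmorphB (real_complex R)) scalerBl rmorph1 scale1r.
    by rewrite -addrA -opprD [r + p]subrK.
  apply: le_trans (hnB _ _ _) _; rewrite hnZ cnR ?subr_ge0 // mulrBl mulVf ?gt_eqF //.
  by move: r2; lra.
Qed.

Section FarVectors.
Variables (b : H -> H -> R[i]) (K : R) (bK : bounded_form b K).

Let K0 : 0 <= K. Proof. by case: bK. Qed.

Lemma formDr x y z : b x (y + z) = b x y + b x z.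
Proof. by case: bK => _ h _ _; rewrite -[y]scale1r h mul1r scale1r. Qed.

Lemma formDl x y z : b (y + z) x = b y x + b z x.
Proof. by case: bK => _ _ h _; rewrite -[y]scale1r h rmorph1 mul1r scale1r. Qed.

Lemma form_le x y : cn (b x y) <= K * hn x * hn y.
Proof. by case: bK. Qed.

Lemma form0r x : b x 0 = 0.
Proof.
apply: cn_eq0; apply/eqP; rewrite eq_le cn_ge0 andbT.
by apply: le_trans (form_le _ _) _; rewrite hn0 mulr0.
Qed.

Lemma form0l x : b 0 x = 0.
Proof.
apply: cn_eq0; apply/eqP; rewrite eq_le cn_ge0 andbT.
by apply: le_trans (form_le _ _) _; rewrite hn0 mulr0 mul0r.
Qed.

Lemma formZr x a y : b x (a *: y) = a * b x y.
Proof. by case: bK => _ h _ _; rewrite -[a *: y]addr0 h form0r addr0. Qed.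

Lemma formZl x a y : b (a *: y) x = a^* * b y x.
Proof. by case: bK => _ _ h _; rewrite -[a *: y]addr0 h form0l addr0. Qed.

Lemma formBr x y z : b x (y - z) = b x y - b x z.
Proof. by rewrite formDr -scaleN1r formZr mulN1r. Qed.

Lemma formBl x y z : b (y - z) x = b y x - b z x.
Proof. by rewrite formDl -scaleN1r formZl rmorphN1 mulN1r. Qed.

Lemma form_sumr n (F : nat -> H) x :
  b x (\sum_(i < n) F i) = \sum_(i < n) b x (F i).
Proof.
by elim: n => [|n IH]; rewrite ?big_ord0 ?form0r // !big_ord_recr formDr IH.
Qed.

Lemma form_suml n (F : nat -> H) x :
  b (\sum_(i < n) F i) x = \sum_(i < n) b (F i) x.
Proof.
by elim: n => [|n IH]; rewrite ?big_ord0 ?form0l // !big_ord_recr formDl IH.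
Qed.

Lemma form_decayr e x : (forall n, ons e n) ->
  forall r, 0 < r -> \forall n \near \oo, cn (b x (e n)) <= r.
Proof.
move=> oe; apply: (@functional_decay (b x) (K * hn x)) => //.
- by case: bK.
- exact: form_le.
Qed.

Lemma form_decayl e x : (forall n, ons e n) ->
  forall r, 0 < r -> \forall n \near \oo, cn (b (e n) x) <= r.
Proof.
move=> oe r r0; have : \forall n \near \oo, cn (b (e n) x)^* <= r.
  apply: (@functional_decay (fun y => (b y x)^*) (K * hn x)) => //.
  - by move=> a y z; case: bK => _ _ -> _; rewrite rmorphD rmorphM /= conjCK.
  - by move=> y; rewrite cnJ; apply: le_trans (form_le _ _) _; rewrite mulrAC.
by apply: filterS => n; rewrite cnJ.
Qed.

Lemma proj_decay f m e : ons f m -> (forall n, ons e n) ->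
  forall r, 0 < r -> \forall n \near \oo, hn (proj f m (e n)) <= r.
Proof.
move=> of_ oe r r0; have m0 : 0 < m.+1%:R :> R by rewrite ltr0n.
have : \forall n \near \oo, forall x, x \in mkseq f m -> cn (ip x (e n)) <= r / m.+1%:R.
  apply: near_seq => x _; apply: (@functional_decay (ip x) (hn x)) => //.
  - by move=> a y z; rewrite ipDr ipZr.
  - exact: cauchy_schwarz.
  - by rewrite divr_gt0.
apply: filterS => n hne; apply: le_trans (hn_sum _ _ _ _) _.
apply: le_trans (_ : \sum_(i < m) r / m.+1%:R <= _).
  apply: ler_sum => i _; rewrite hnZ (ons_hn of_) // mulr1; apply: hne.
  by apply: map_f; rewrite mem_iota ltn_ord.
rewrite sumr_const card_ord -(mulr_natr _ m) mulrAC ler_pdivrMr // ler_pM2l //.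
by rewrite ler_nat.
Qed.

Variables (e : nat -> H) (w : R[i]).

(** That [w] is a cluster value of the diagonal of [b] is stated against every
    property that holds eventually, to combine it with the decay lemmas. *)
Hypotheses (oe : forall n, ons e n)
  (ew : forall r, 0 < r -> forall P : nat -> Prop, (\forall n \near \oo, P n) ->
    exists2 n, P n & cn (b (e n) (e n) - w) <= r).

(** Far along [e], the vector [e n] is nearly orthogonal to the family [f] and
    nearly [b]-orthogonal to [X], by the Bessel inequalities; [unit_near] then
    corrects it to be orthogonal to [f] at small cost in [b]. *)
Lemma far_vector f m (X : seq H) r : ons f m -> 0 < r ->
  exists v, [/\ hn v = 1, forall i, (i < m)%N -> ip (f i) v = 0,
    cn (b v v - w) <= r &
    forall x, x \in X -> cn (b x v) <= r /\ cn (b v x) <= r].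
Proof.
move=> of_ r0; pose S := \sum_(x <- X) hn x.
have S0 : 0 <= S by rewrite sumr_ge0 // => x _; rewrite hn_ge0.
have xS x : x \in X -> hn x <= S.
  move=> xX; rewrite /S (big_rem x) //= lerDl.
  by rewrite sumr_ge0 // => y _; rewrite hn_ge0.
(* [4 K] accounts for the change of [b v v] and [2 K S] for that of [b x v] when
   [e n] moves by at most [2 d]. *)
pose Q := 4 * K + 2 * (K * S) + 1.
have KS0 : 0 <= K * S by rewrite mulr_ge0.
have Q0 : 0 < Q by rewrite /Q; have := K0; lra.
pose d := Num.min (r / 2 / Q) (1 / 2).
have d0 : 0 < d by rewrite lt_min !divr_gt0.
have r20 : 0 < r / 2 by rewrite divr_gt0.
have h1 := proj_decay of_ oe d0.
have h2 : \forall n \near \oo, forall x, x \in X -> cn (b x (e n)) <= r / 2.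
  by apply: near_seq => x _; exact: form_decayr.
have h3 : \forall n \near \oo, forall x, x \in X -> cn (b (e n) x) <= r / 2.
  by apply: near_seq => x _; exact: form_decayl.
have [n [n1 [n2 n3]] nw] := ew r20 (filterI h1 (filterI h2 h3)).
have e1 : hn (e n) = 1 by exact: (ons_hn (@oe n.+1) (ltnSn n)).
have [dQ d1] : d * Q <= r / 2 /\ d <= 1 / 2.
  by rewrite -ler_pdivlMr //; split; rewrite /d ge_min lexx ?orbT.
have [|v [v1 fv ve]] := unit_near of_ e1; first by move: n1 d1; lra.
have ve2 : hn (v - e n) <= 2 * d by apply: le_trans ve _; rewrite ler_pM2l.
have dQE : d * Q = 4 * (K * d) + 2 * (K * d * S) + d by rewrite /Q; ring.
have Kd : 0 <= K * d by rewrite mulr_ge0 // ltW.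
have KdS : 0 <= K * d * S by rewrite mulr_ge0.
have Kve : K * hn (v - e n) <= 2 * (K * d).
  by rewrite mulrCA ler_wpM2l.
exists v; split=> //.
- have -> : b v v - w = (b (v - e n) v + b (e n) (v - e n)) + (b (e n) (e n) - w).
    by rewrite formBl formBr; ring.
  apply: le_trans (cnD _ _) _; apply: le_trans (lerD (cnD _ _) nw) _.
  have a1 := form_le (v - e n) v; have a2 := form_le (e n) (v - e n).
  by move: a1 a2; rewrite v1 e1 !mulr1; move: Kve; lra.
- have vb x : x \in X -> K * hn x * hn (v - e n) <= r / 2.
    move=> xX; apply: le_trans (_ : S * (2 * (K * d)) <= _); last by move: dQE; lra.
    rewrite mulrAC mulrC; apply: ler_pM => //; first exact: hn_ge0.
      by rewrite mulr_ge0 ?hn_ge0.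
    exact: xS.
  move=> x xX; split.
  + rewrite -[v](subrK (e n)) addrC formDr.
    apply: le_trans (cnD _ _) _.
    by have := n2 _ xX; have := form_le x (v - e n); have := vb _ xX; lra.
  + rewrite -[v](subrK (e n)) addrC formDl.
    apply: le_trans (cnD _ _) _.
    have := n3 _ xX; have := form_le (v - e n) x; have := vb _ xX.
    by rewrite [K * hn x * _]mulrAC; lra.
Qed.

(** Picking the vectors one at a time, each nearly [b]-orthogonal to the previous
    ones, makes the matrix of [b] on the new vectors nearly [w] times the
    identity. *)
Lemma far_family k f m (X : seq H) r : ons f m -> 0 < r ->
  exists g, [/\ ons g (m + k), forall i, (i < m)%N -> g i = f i,
    forall i j, (i < k)%N -> (j < k)%N ->
      cn (b (g (m + i)%N) (g (m + j)%N) - (i == j)%:R * w) <= r &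
    forall x i, x \in X -> (i < k)%N ->
      cn (b x (g (m + i)%N)) <= r /\ cn (b (g (m + i)%N) x) <= r].
Proof.
move=> of_ r0; elim: k => [|k [g [og gf gg gX]]].
  by exists f; rewrite addn0.
have [v [v1 gv vw vX]] := far_vector (X ++ mkseq (fun i => g (m + i)%N) k) og r0.
pose h := extend g (m + k) v.
have hl i : (i < k)%N -> h (m + i)%N = g (m + i)%N.
  by move=> ik; rewrite /h extendl // ltn_add2l.
have hk : h (m + k)%N = v by rewrite /h extendr.
have gm i : (i < k)%N -> g (m + i)%N \in X ++ mkseq (fun i => g (m + i)%N) k.
  by move=> ik; rewrite mem_cat (map_f (fun i => g (m + i)%N)) ?orbT // mem_iota.
exists h; split.
- by rewrite addnS; apply: ons_extend.
- by move=> i im; rewrite /h extendl ?gf // ltn_addr.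
- move=> i j; rewrite !ltnS (leq_eqVlt i) (leq_eqVlt j).
  move=> /predU1P[->|ik] /predU1P[->|jk].
  + by rewrite eqxx mul1r hk.
  + by rewrite hk hl // gtn_eqF // mul0r subr0; have [] := vX _ (gm _ jk).
  + by rewrite hk hl // ltn_eqF // mul0r subr0; have [] := vX _ (gm _ ik).
  + by rewrite !hl //; exact: gg.
- move=> x i xX; rewrite ltnS leq_eqVlt => /predU1P[->|ik].
    by rewrite hk; apply: vX; rewrite mem_cat xX.
  by rewrite hl //; exact: gX.
Qed.

End FarVectors.

End Forms.

(** * Rotating a finite-dimensional subspace *)

Section Rotation.
Variables (R : realType) (H : lmodType R[i]) (dot : {dot H for Num.conj}).
Local Notation ip := (ip dot).
Local Notation hn := (hn dot).
Local Notation ons := (ons dot).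
Local Notation proj := (proj dot).

(** A unitary operator together with its adjoint; boundedness follows. *)
Definition unitary_pair (U V : H -> H) :=
  [/\ linear U, linear V, forall x y, ip (V x) y = ip x (U y),
      V \o U = id & U \o V = id].

Lemma linear_sub (A : H -> H) x y : linear A -> A (x - y) = A x - A y.
Proof. by move=> lA; rewrite [x - y]addrC -scaleN1r lA scaleN1r addrC. Qed.

Lemma linear_zero (A : H -> H) : linear A -> A 0 = 0.
Proof. by move=> lA; have := linear_sub 0 0 lA; rewrite !subrr. Qed.

Lemma linear_scale (A : H -> H) a x : linear A -> A (a *: x) = a *: A x.
Proof. by move=> lA; have := lA a x 0; rewrite (linear_zero lA) !addr0. Qed.

Lemma linear_sum (A : H -> H) n (F : nat -> H) : linear A ->
  A (\sum_(i < n) F i) = \sum_(i < n) A (F i).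
Proof.
move=> lA; elim: n => [|n IH]; first by rewrite !big_ord0 (linear_zero lA).
by rewrite !big_ord_recr /= -IH -{1}[\sum_(i < n) F i]scale1r lA scale1r.
Qed.

Lemma unitary_pair_hn U V x : unitary_pair U V -> hn (U x) = hn x.
Proof.
move=> [_ _ adj VU _]; apply: hn_eqP.
by rewrite -adj -[V (U x)]/((V \o U) x) VU.
Qed.

Lemma unitary_pairC U V : unitary_pair U V -> unitary_pair V U.
Proof.
move=> [lU lV adj VU UV]; split=> // x y.
by rewrite ipC -adj -ipC.
Qed.

Lemma unitary_pair_ip U V x y : unitary_pair U V -> ip (V x) (V y) = ip x y.
Proof. by move=> [_ _ adj _ UV]; rewrite adj -[U (V y)]/((U \o V) y) UV. Qed.

Lemma unitary_pair_comp U V U' V' : unitary_pair U V -> unitary_pair U' V' ->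
  unitary_pair (U' \o U) (V \o V').
Proof.
move=> [lU lV adj VU UV] [lU' lV' adj' VU' UV']; split.
- by move=> a x y /=; rewrite lU lU'.
- by move=> a x y /=; rewrite lV' lV.
- by move=> x y /=; rewrite adj adj'.
- apply/funext => x /=; rewrite -[V' _]/((V' \o U') (U x)) VU'.
  by rewrite -[LHS]/((V \o U) x) VU.
- apply/funext => x /=; rewrite -[U _]/((U \o V) (V' x)) UV.
  by rewrite -[LHS]/((U' \o V') x) UV'.
Qed.

Lemma unitary_pair_id : unitary_pair id id.
Proof. by []. Qed.

(** The rotation by the angle of cosine [c] and sine [s] in each plane spanned by
    [f i] and [f (m + i)], and the identity on the orthogonal complement of
    these planes. *)
Definition rot (f : nat -> H) m (c s : R) x :=
  x + \sum_(i < m)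
    (((c - 1)%:C * ip (f i) x - s%:C * ip (f (m + i)%N) x) *: f i
     + (s%:C * ip (f i) x + (c - 1)%:C * ip (f (m + i)%N) x) *: f (m + i)%N).

Variables (f : nat -> H) (m : nat).

Lemma rot_linear c s : linear (rot f m c s).
Proof.
move=> a x y; rewrite /rot scalerDr addrACA; congr (_ + _).
rewrite scaler_sumr -big_split /=; apply: eq_bigr => i _.
rewrite !ipDr !ipZr scalerDr !scalerA addrACA -!scalerDl.
by congr (_ *: _ + _ *: _); ring.
Qed.

Lemma rot_adjoint c s x y : ip (rot f m c s x) y = ip x (rot f m c (- s) y).
Proof.
rewrite /rot ipDl ipDr ip_suml ip_sumr; congr (_ + _); apply: eq_bigr => i _.
have kJ : ((c - 1)%:C : R[i])^* = (c - 1)%:C := conjR _; set k := (c - 1)%:C in kJ *.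
rewrite ipDl ipDr !ipZl !ipZr !(ipC dot x) (rmorphN (real_complex R)) /=.
by rewrite rmorphB rmorphD !rmorphM /= kJ !conjR; ring.
Qed.

Hypothesis of_ : ons f (m + m).

Lemma ip_lr i j : (i < m)%N -> (j < m)%N -> ip (f i) (f (m + j)%N) = 0.
Proof.
move=> im jm; rewrite of_ ?ltn_add2l ?ltn_addr // ltn_eqF //.
by rewrite (leq_trans im) ?leq_addr.
Qed.

Lemma ip_rl i j : (i < m)%N -> (j < m)%N -> ip (f (m + i)%N) (f j) = 0.
Proof. by move=> im jm; rewrite ipC ip_lr // rmorph0. Qed.

Lemma ip_rotl c s x j : (j < m)%N ->
  ip (f j) (rot f m c s x) = c%:C * ip (f j) x - s%:C * ip (f (m + j)%N) x.
Proof.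
move=> jm; rewrite /rot ipDr ip_sumr (bigD1 (Ordinal jm)) //= big1 => [|i ij].
  rewrite ipDr !ipZr ip_lr // of_ ?ltn_addr // eqxx mulr1 mulr0 !addr0.
  by rewrite (rmorphB (real_complex R)) rmorph1; ring.
rewrite ipDr !ipZr ip_lr // of_ ?ltn_addr //.
by rewrite (_ : (j == i) = false) ?mulr0 ?addr0 // eq_sym; apply: negbTE.
Qed.

Lemma ip_rotr c s x j : (j < m)%N ->
  ip (f (m + j)%N) (rot f m c s x) = s%:C * ip (f j) x + c%:C * ip (f (m + j)%N) x.
Proof.
move=> jm; rewrite /rot ipDr ip_sumr (bigD1 (Ordinal jm)) //= big1 => [|i ij].
  rewrite ipDr !ipZr ip_rl // of_ ?ltn_add2l // eqxx mulr1 mulr0 !addr0.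
  by rewrite (rmorphB (real_complex R)) rmorph1; ring.
rewrite ipDr !ipZr ip_rl // of_ ?ltn_add2l // eqn_add2l.
by rewrite (_ : (j == i) = false) ?mulr0 ?addr0 // eq_sym; apply: negbTE.
Qed.

Lemma rotK c s : c ^+ 2 + s ^+ 2 = 1 -> rot f m c (- s) \o rot f m c s = id.
Proof.
move=> cs; apply/funext => x /=; rewrite {1}/rot {1}/rot -[RHS]addr0 -addrA.
congr (_ + _); rewrite -big_split big1 //= => i _.
rewrite addrACA -!scalerDl ip_rotl // ip_rotr //.
have csC : c%:C ^+ 2 + s%:C ^+ 2 = 1 :> R[i].
  by rewrite -!(rmorphXn (real_complex R)) -(rmorphD (real_complex R)) cs.
rewrite (rmorphB (real_complex R)) (rmorphN (real_complex R)) rmorph1 /=.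
rewrite [X in X *: _](_ : _ = (c%:C ^+ 2 + s%:C ^+ 2 - 1) * ip (f i) x); last by ring.
rewrite [X in _ + X *: _](_ : _ = (c%:C ^+ 2 + s%:C ^+ 2 - 1) * ip (f (m + i)%N) x);
  last by ring.
by rewrite csC subrr !mul0r !scale0r addr0.
Qed.

Lemma rot_unitary c s : c ^+ 2 + s ^+ 2 = 1 ->
  unitary_pair (rot f m c (- s)) (rot f m c s).
Proof.
move=> cs; split; try exact: rot_linear; try exact: rot_adjoint.
  by rewrite -{1}[s]opprK rotK // sqrrN.
exact: rotK.
Qed.

(** The partial isometry that sends [f i] to [f (m + i)]. *)
Definition shift x := \sum_(i < m) ip (f i) x *: f (m + i)%N.

Lemma rot_span c s x : proj f m x = x ->
  rot f m c s x = c%:C *: x + s%:C *: shift x.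
Proof.
move=> px; have p0 i : (i < m)%N -> ip (f (m + i)%N) x = 0.
  by move=> im; rewrite -px /proj ip_sumr big1 // => j _; rewrite ipZr ip_rl // mulr0.
rewrite /rot /shift.
have -> : c%:C *: x = x + \sum_(i < m) ((c - 1)%:C * ip (f i) x) *: f i.
  rewrite -[in RHS]px (_ : \sum_(i < m) _ = (c - 1)%:C *: proj f m x).
    by rewrite px (rmorphB (real_complex R)) rmorph1 scalerBl scale1r addrC subrK.
  by rewrite scaler_sumr px; apply: eq_bigr => i _; rewrite scalerA.
rewrite -addrA; congr (_ + _); rewrite scaler_sumr -big_split; apply: eq_bigr => i _.
by rewrite p0 // !mulr0 subr0 addr0 scalerA.
Qed.

End Rotation.

(** * The form along a rotation *)

Section Core.
Variables (R : realType) (H : lmodType R[i]) (dot : {dot H for Num.conj}).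
Local Notation ip := (ip dot).
Local Notation hn := (hn dot).
Local Notation ons := (ons dot).
Local Notation proj := (proj dot).

Variables (b : H -> H -> R[i]) (K : R) (bK : bounded_form dot b K).
Variables (f : nat -> H) (m : nat) (w : R[i]) (d : R) (X : seq H).
Hypotheses (of_ : ons f (m + m))
  (fw : forall i j, (i < m)%N -> (j < m)%N ->
      cn (b (f (m + i)%N) (f (m + j)%N) - (i == j)%:R * w) <= d)
  (fX : forall x i, x \in X -> (i < m)%N ->
      cn (b x (f (m + i)%N)) <= d /\ cn (b (f (m + i)%N) x) <= d).

Lemma sum_le_ord n (F : 'I_n -> R) (B : R) : (forall i, F i <= B) ->
  \sum_(i < n) F i <= n%:R * B.
Proof.
move=> FB; apply: le_trans (_ : \sum_(i < n) B <= _).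
  by apply: ler_sum => i _; exact: FB.
by rewrite sumr_const card_ord mulr_natl.
Qed.

Let ofm : ons f m. Proof. by apply: ons_le of_; rewrite leq_addr. Qed.

Lemma coef_le i x : (i < m)%N -> cn (ip (f i) x) <= hn x.
Proof.
move=> im; apply: le_trans (cauchy_schwarz _ _ _) _.
by rewrite (ons_hn ofm im) mul1r.
Qed.

Lemma cross_small x y : x \in X -> cn (b x (shift dot f m y)) <= m%:R * (hn y * d).
Proof.
move=> xX; rewrite /shift (form_sumr bK m (fun i => ip (f i) y *: f (m + i)%N)).
apply: le_trans (cn_sum _ _ _) (sum_le_ord _) => i.
rewrite (formZr bK) cnM; apply: ler_pM; rewrite ?cn_ge0 ?coef_le //.
by have [] := fX xX (ltn_ord i).
Qed.

Lemma cross_small' x y : x \in X -> cn (b (shift dot f m y) x) <= m%:R * (hn y * d).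
Proof.
move=> xX; rewrite /shift (form_suml bK m (fun i => ip (f i) y *: f (m + i)%N)).
apply: le_trans (cn_sum _ _ _) (sum_le_ord _) => i.
rewrite (formZl bK) cnM cnJ; apply: ler_pM; rewrite ?cn_ge0 ?coef_le //.
by have [] := fX xX (ltn_ord i).
Qed.

(** On the shifted vectors the matrix of [b] is nearly [w] times the identity, so
    [b] is nearly [w] times the inner product on their span. *)
Lemma shift_scalar x y : proj f m x = x -> proj f m y = y ->
  cn (b (shift dot f m x) (shift dot f m y) - w * ip x y)
    <= m%:R * (m%:R * (hn x * hn y * d)).
Proof.
move=> px py; rewrite -{2}px -{2}py /proj.
rewrite (ip_ons (fun i => ip (f i) x) (fun i => ip (f i) y) ofm).
rewrite /shift (form_suml bK m (fun i => ip (f i) x *: f (m + i)%N)).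
rewrite mulr_sumr -sumrB; apply: le_trans (cn_sum _ _ _) (sum_le_ord _) => i.
rewrite (formZl bK) (form_sumr bK m (fun i => ip (f i) y *: f (m + i)%N)).
have -> : w * ((ip (f i) x)^* * ip (f i) y) =
    (ip (f i) x)^* * \sum_(j < m) ip (f j) y * ((i == j :> nat)%:R * w).
  rewrite (bigD1 i) //= eqxx mul1r big1 ?addr0; first by ring.
  move=> j ij; rewrite (_ : (i == j :> nat) = false) ?mul0r ?mulr0 //.
  by rewrite eq_sym; apply: negbTE.
rewrite -mulrBr -sumrB cnM cnJ.
apply: le_trans (_ : hn x * (m%:R * (hn y * d)) <= _); last first.
  by rewrite [X in _ <= X](_ : _ = hn x * (m%:R * (hn y * d))) //; ring.
apply: ler_pM; rewrite ?cn_ge0 ?coef_le //.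
apply: le_trans (cn_sum _ _ _) (sum_le_ord _) => j.
rewrite (formZr bK) -mulrBr cnM; apply: ler_pM; rewrite ?cn_ge0 ?coef_le //.
exact: fw.
Qed.

Definition rot_const (p : H * H) : R :=
  m%:R * hn p.1 + m%:R * hn p.2 + m%:R * (m%:R * (hn p.1 * hn p.2)).

(** With [rot x = c x + s (shift x)] the form splits into [c^2 b x y], two small
    cross terms, and [s^2] times the form on the shifted vectors. *)
Lemma rot_form c s x y : c ^+ 2 + s ^+ 2 = 1 -> 0 <= c -> 0 <= s ->
  proj f m x = x -> proj f m y = y -> x \in X -> y \in X ->
  cn (b (rot dot f m c s x) (rot dot f m c s y)
      - ((c ^+ 2)%:C * b x y + (s ^+ 2)%:C * (w * ip x y)))
    <= rot_const (x, y) * d.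
Proof.
move=> cs c0 s0 px py xX yX; rewrite !(rot_span of_) //.
rewrite (formDl bK) !(formDr bK) !(formZl bK) !(formZr bK) !conjR.
set Bxy := b (shift _ _ _ _) (shift _ _ _ _).
have h1 := cross_small y xX; have h2 := cross_small' x yX.
have h3 := shift_scalar px py; rewrite -/Bxy in h3.
set A := b x (shift _ _ _ _) in h1 *; set B := b (shift _ _ _ _) y in h2 *.
rewrite (_ : _ - _ = (c * s)%:C * A + (c * s)%:C * B + (s ^+ 2)%:C * (Bxy - w * ip x y));
  last by rewrite !(rmorphM (real_complex R)); ring.
have cs1 : 0 <= c * s <= 1.
  by rewrite mulr_ge0 //=; nra.
have s1 : 0 <= s ^+ 2 <= 1 by rewrite sqr_ge0 /=; nra.
have le1 (k : R) z B0 : 0 <= k <= 1 -> cn z <= B0 -> cn (k%:C * z) <= B0.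
  by move=> /andP[k0 k1] zB; rewrite cnM cnR //; have := cn_ge0 z; nra.
apply: le_trans (cnD _ _) _; apply: le_trans (lerD (cnD _ _) (lexx _)) _.
have := le1 _ _ _ cs1 h1; have := le1 _ _ _ cs1 h2; have := le1 _ _ _ s1 h3.
rewrite /rot_const /=; lra.
Qed.

End Core.

(** The span of the given vectors is rotated, by the angle of squared cosine [t],
    towards a subspace on which [b] is nearly [w] times the inner product and
    which is nearly [b]-orthogonal to these vectors; [rot_form] then bounds the
    error on each pair. *)
Lemma rotate_towards (R : realType) (H : lmodType R[i]) (dot : {dot H for Num.conj})
    (b : H -> H -> R[i]) (K : R) (e : nat -> H) (w : R[i]) :
  bounded_form dot b K -> (forall n, ons dot e n) ->
  (forall r, 0 < r -> forall P : nat -> Prop, (\forall n \near \oo, P n) ->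
    exists2 n, P n & cn (b (e n) (e n) - w) <= r) ->
  forall (S : seq (H * H)) (t r : R), 0 <= t <= 1 -> 0 < r ->
  exists U V, unitary_pair dot U V /\
    cn (\sum_(p <- S) b (V p.1) (V p.2)
        - (t%:C * \sum_(p <- S) b p.1 p.2
           + (1 - t)%:C * (w * \sum_(p <- S) ip dot p.1 p.2))) <= r.
Proof.
move=> bK oe ew S t r /andP[t0 t1] r0.
pose X := map fst S ++ map snd S.
have [f [m [of_ fX]]] := capture dot X.
pose Q := \sum_(p <- S) rot_const dot m p.
have Q0 : 0 <= Q.
  by rewrite sumr_ge0 // => p _; rewrite !addr_ge0 ?mulr_ge0 ?hn_ge0 ?ler0n.
have Q1 : 0 < Q + 1 by rewrite ltr_wpDl.
have d0 : 0 < r / (Q + 1) by rewrite divr_gt0.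
have [g [og gf gw gX]] := far_family bK oe ew m X of_ d0.
pose c := Num.sqrt t; pose s := Num.sqrt (1 - t).
have c2 : c ^+ 2 = t by rewrite sqr_sqrtr.
have s2 : s ^+ 2 = 1 - t by rewrite sqr_sqrtr // subr_ge0.
have cs : c ^+ 2 + s ^+ 2 = 1 by rewrite c2 s2 addrC subrK.
exists (rot dot g m c (- s)), (rot dot g m c s); split; first exact: rot_unitary.
have gp x : x \in X -> proj dot g m x = x.
  by move=> xX; rewrite (@eq_proj _ _ _ _ f) // fX.
rewrite !mulr_sumr -big_split /= -sumrB -s2 -c2.
apply: le_trans (_ : Q * (r / (Q + 1)) <= _); last first.
  by rewrite mulrA ler_pdivrMr // mulrDr mulr1 mulrC lerDl ltW.
rewrite /Q mulr_suml; apply: le_trans (cn_sum _ _ _) _.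
rewrite big_seq [X in _ <= X]big_seq; apply: ler_sum => p pS.
have p1 : p.1 \in X by rewrite mem_cat map_f.
have p2 : p.2 \in X by rewrite mem_cat orbC map_f.
have -> : p = (p.1, p.2) by case: (p).
exact: (rot_form bK og gw gX cs (sqrtr_ge0 _) (sqrtr_ge0 _) (gp _ p1) (gp _ p2)).
Qed.

(** * Schmidt decompositions and singular values *)

Lemma sum_shift (R : realType) (u : nat -> R) N n :
  \sum_(i < n) u (N + i)%N = \sum_(N <= i < N + n) u i.
Proof.
rewrite -[X in index_iota X _]add0n big_addn addKn big_mkord.
by apply: eq_bigr => i _; rewrite addnC.
Qed.

Section Schmidt.
Variables (R : realType) (H : completeNormedModType R[i]).
Variables (dot : {dot H for Num.conj}).
Hypothesis norm_dot : forall x : H, `|x| ^+ 2 = dot x x.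
Local Notation ip := (ip dot).
Local Notation hn := (hn dot).
Local Notation ons := (ons dot).

(** The partial sums of a Schmidt decomposition, which are also the finite-rank
    truncations of the operator. *)
Definition schmidt_sum (s : nat -> R) (f g : nat -> H) n x : H :=
  \sum_(k < n) ((s k)%:C * ip (f k) x) *: g k.

Definition schmidt (A : H -> H) (s : nat -> R) (f g : nat -> H) : Prop :=
  [/\ (forall n, 0 <= s n) /\ (forall m n, (m <= n)%N -> s n <= s m),
      s @ \oo --> (0 : R),
      forall n, ons f n, forall n, ons g n &
      forall x, (fun n => schmidt_sum s f g n x) @ \oo --> A x].

Lemma is_singular_valuesP A s :
  is_singular_values dot A s <-> exists f g, schmidt A s f g.
Proof.
have eS (f g : nat -> H) x : series (fun n => ((s n)%:C * braket dot (f n) x) *: g n)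
    = (fun n => schmidt_sum s f g n x).
  by apply/funext => n; rewrite /series /= big_mkord.
split=> [[s0 sd sl [f [g [/orthonormal_systemP of_ /orthonormal_systemP og fg]]]]|].
  by exists f, g; split=> // x; rewrite -eS; exact: fg.
move=> [f [g [[s0 sd] sl of_ og fg]]]; split=> //; exists f, g.
split; [exact/orthonormal_systemP|exact/orthonormal_systemP|].
by move=> x; rewrite eS; exact: fg.
Qed.

Lemma hn2_schmidt_sum s f g n x : (forall n, 0 <= s n) -> ons g n ->
  hn (schmidt_sum s f g n x) ^+ 2 = \sum_(k < n) s k ^+ 2 * cn (ip (f k) x) ^+ 2.
Proof.
move=> s0 og; rewrite /schmidt_sum (hn2_ons (fun k => (s k)%:C * ip (f k) x) og).
by apply: eq_bigr => k _; rewrite cnM cnR // exprMn.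
Qed.

Lemma schmidt_upper A s f g n x : schmidt A s f g ->
  (forall i, (i < n)%N -> ip (f i) x = 0) -> hn (A x) <= s n * hn x.
Proof.
move=> [[s0 sd] _ of_ og fg] fx; apply: (hn_cvg_le norm_dot (fg x)).
apply: nearW => N; rewrite -(@ler_pXn2r _ 2) ?nnegrE ?mulr_ge0 ?hn_ge0 //.
rewrite hn2_schmidt_sum // exprMn.
apply: le_trans (_ : \sum_(k < N) s n ^+ 2 * cn (ip (f k) x) ^+ 2 <= _).
  apply: ler_sum => k _; have [kn|nk] := ltnP k n.
    by rewrite fx // cn0 expr0n !mulr0.
  by rewrite ler_wpM2r ?sqr_ge0 // ler_pXn2r ?nnegrE // sd.
by rewrite -mulr_sumr ler_wpM2l ?sqr_ge0 // bessel.
Qed.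

Lemma schmidt_lower A s (f g : nat -> H) n (v : nat -> R[i])
    (x := \sum_(i < n.+1) v i *: f i) :
  schmidt A s f g -> s n * hn x <= hn (A x).
Proof.
move=> [[s0 sd] _ of_ og fg].
have stable N : (n < N)%N -> schmidt_sum s f g N x = schmidt_sum s f g n.+1 x.
  move=> nN; rewrite /schmidt_sum.
  rewrite -!(big_mkord xpredT (fun k => ((s k)%:C * ip (f k) x) *: g k)).
  rewrite (@big_cat_nat _ _ _ n.+1 0 N) //= [X in _ + X](_ : _ = 0) ?addr0 //.
  rewrite big_nat_cond big1 // => k /andP[/andP[nk kN] _].
  rewrite /x ip_sumr big1 ?mulr0 ?scale0r // => i _.
  have ik : (i < k)%N by rewrite (leq_trans (ltn_ord i)).
  by rewrite ipZr (@of_ k.+1) ?(leqW ik) // gtn_eqF // mulr0.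
have -> : A x = schmidt_sum s f g n.+1 x.
  apply: (cvg_unique (@norm_hausdorff _ _) (fg x)).
  apply: cvg_near_cst; near=> N; apply: stable.
  by near: N; exact: nbhs_infty_gt.
rewrite -(@ler_pXn2r _ 2) ?nnegrE ?mulr_ge0 ?hn_ge0 //.
rewrite hn2_schmidt_sum // exprMn /x (hn2_ons v (@of_ n.+1)) mulr_sumr.
apply: ler_sum => i _; rewrite (ip_onsr v (@of_ n.+1)) //.
by rewrite ler_wpM2r ?sqr_ge0 // ler_pXn2r ?nnegrE // sd // -ltnS.
Unshelve. all: by end_near. Qed.

(** Dimension count: [n] linear conditions on [n + 1] coefficients have a
    nontrivial solution, here a vector in the kernel of their matrix. *)
Lemma exists_orthogonal_comb (f g : nat -> H) n : exists v : nat -> R[i],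
  (exists2 i, (i < n.+1)%N & v i != 0) /\
  forall j, (j < n)%N -> ip (f j) (\sum_(i < n.+1) v i *: g i) = 0.
Proof.
pose M := \matrix_(i < n.+1, j < n) ip (f j) (g i).
have kM : kermx M != 0.
  by rewrite kermx_eq0 /row_free neq_ltn (leq_ltn_trans (rank_leq_col M)).
have /rowV0Pn[v /sub_kermxP vM v0] := kM.
exists (fun i => v ord0 (inord i)); split.
  have /rV0Pn[i vi] := v0; exists i; first exact: ltn_ord.
  by rewrite inord_val.
move=> j jn; have /matrixP/(_ ord0 (Ordinal jn)) := vM; rewrite !mxE => <-.
by rewrite ip_sumr; apply: eq_bigr => i _; rewrite ipZr mxE inord_val.
Qed.

(** Min-max: restricted to a combination of the first [n + 1] right vectors of
    one decomposition that is orthogonal to the first [n] of the other, [A]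
    expands by at least [s' n] and at most [s n]. *)
Lemma schmidt_le A s s' f g f' g' n :
  schmidt A s f g -> schmidt A s' f' g' -> s' n <= s n.
Proof.
move=> sA sA'; have [v [[i i_n vi] fx]] := exists_orthogonal_comb f f' n.
have lo := schmidt_lower n v sA'.
have up := schmidt_upper sA fx; set x := \sum_(_ < _) _ in lo up.
have x0 : 0 < hn x.
  rewrite -(@ltr_pXn2r _ 2) ?nnegrE ?hn_ge0 // expr0n /x.
  case: sA' => _ _ of' _ _; rewrite (hn2_ons v (@of' n.+1)).
  rewrite (bigD1 (Ordinal i_n)) //= ltr_wpDr //.
    by rewrite sumr_ge0 // => j _; rewrite sqr_ge0.
  by rewrite exprn_gt0 // lt_def cn_ge0 andbT; apply: contra_neq vi; exact: cn_eq0.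
by rewrite -(ler_pM2r x0) (le_trans lo).
Qed.

Lemma schmidt_singular_values A s f g : schmidt A s f g -> singular_values dot A = s.
Proof.
move=> sA; rewrite /singular_values; case: xgetP => [s' _|/(_ s)]; last first.
  by case; apply/is_singular_valuesP; exists f, g.
move=> /is_singular_valuesP[f' [g' sA']]; apply/funext => n.
by apply/eqP; rewrite eq_le (schmidt_le n sA sA') (schmidt_le n sA' sA).
Qed.

Lemma power_sum_le (r B : R) (s : nat -> R) :
  (forall n, \sum_(i < n) s i `^ r <= B) -> (power_sum r s <= B%:E)%E.
Proof.
move=> sB; apply: lime_le.
  by apply: is_cvg_nneseries => n _ _; rewrite lee_fin powR_ge0.
by apply: nearW => n; rewrite sumEFin lee_fin big_mkord.
Qed.

Lemma power_sum_ge0 (r : R) (s : nat -> R) : (0 <= power_sum r s)%E.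
Proof. by apply: nneseries_ge0 => n _ _; rewrite lee_fin powR_ge0. Qed.

Lemma power_sum_partial (r : R) (s : nat -> R) n : (power_sum r s < +oo)%E ->
  \sum_(i < n) s i `^ r <= fine (power_sum r s).
Proof.
move=> soo; rewrite -lee_fin fineK ?ge0_fin_numE ?power_sum_ge0 //.
rewrite -(big_mkord xpredT (fun i => s i `^ r)) -sumEFin; apply: nneseries_lim_ge => k _ _.
by rewrite lee_fin powR_ge0.
Qed.

Lemma schmidt_schatten (r B : R) A s f g : 0 < r -> compact_op A -> schmidt A s f g ->
  (forall n, \sum_(i < n) s i `^ r <= B) ->
  schatten dot r%:E A /\ schatten_norm dot r%:E A <= B `^ r^-1.
Proof.
move=> r0 cA sA sB; have pB := power_sum_le sB.
have poo : (power_sum r s < +oo)%E by apply: le_lt_trans pB _; exact: ltry.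
split.
  by split=> //; exists s => //; apply/is_singular_valuesP; exists f, g.
rewrite /schatten_norm (schmidt_singular_values sA).
have fB : fine (power_sum r s) <= B.
  by rewrite -lee_fin fineK ?ge0_fin_numE ?power_sum_ge0.
have f0 : 0 <= fine (power_sum r s) by rewrite fine_ge0 ?power_sum_ge0.
by apply: ge0_ler_powR; rewrite ?invr_ge0 ?(ltW r0) ?nnegrE // (le_trans f0).
Qed.

Lemma schmidt_conj A s f g U V : schmidt A s f g -> unitary_pair dot U V ->
  schmidt (V \o A \o U) s (V \o f) (V \o g).
Proof.
move=> [sd sl of_ og fg] uUV; have [_ linV adj _ _] := uUV.
have uVU := unitary_pairC uUV.
have VB x y : V (x - y) = V x - V y by exact: linear_sub.
split=> //.
- by move=> n i j im jm /=; rewrite (unitary_pair_ip _ _ uUV) (of_ n).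
- by move=> n i j im jm /=; rewrite (unitary_pair_ip _ _ uUV) (og n).
- move=> x; apply/(cvg_hnP norm_dot) => e e0.
  have /(cvg_hnP norm_dot)/(_ e e0) := fg (U x); apply: filterS => n.
  rewrite -(unitary_pair_hn _ uVU) VB; congr (hn (_ - _) < _).
  rewrite /schmidt_sum (linear_sum n (fun k => ((s k)%:C * ip (f k) (U x)) *: g k) linV).
  by apply: eq_bigr => k _; rewrite linear_scale // adj.
Qed.

Lemma schmidt_tail A s f g n : schmidt A s f g ->
  schmidt (A - schmidt_sum s f g n) (fun i => s (n + i)%N)
    (fun i => f (n + i)%N) (fun i => g (n + i)%N).
Proof.
move=> [[s0 sd] sl of_ og fg]; split.
- by split=> // i j ij; apply: sd; rewrite leq_add2l.
- by have := sl; rewrite -(cvg_shiftn n); under eq_fun do rewrite addnC.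
- by move=> N i j iN jN; rewrite (of_ (n + N)%N) ?ltn_add2l // eqn_add2l.
- by move=> N i j iN jN; rewrite (og (n + N)%N) ?ltn_add2l // eqn_add2l.
- move=> x; have eS N : schmidt_sum (fun i => s (n + i)%N) (fun i => f (n + i)%N)
      (fun i => g (n + i)%N) N x = schmidt_sum s f g (n + N) x - schmidt_sum s f g n x.
    by rewrite /schmidt_sum big_split_ord /= addrAC subrr add0r.
  apply/(cvg_hnP norm_dot) => e e0.
  have /(cvg_hnP norm_dot)/(_ e e0)[N _ hN] := fg x; exists N => // k /= Nk.
  rewrite eS -[(A - _) x]/(A x - schmidt_sum s f g n x) opprB addrA subrK.
  by apply: hN; rewrite /= (leq_trans Nk) ?leq_addl.
Qed.

Lemma schmidt_trunc s f g n : (forall i, 0 <= s i) ->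
  (forall i j, (i <= j)%N -> (j < n)%N -> s j <= s i) ->
  (forall N, ons f N) -> (forall N, ons g N) ->
  schmidt (schmidt_sum s f g n) (fun i => if (i < n)%N then s i else 0) f g.
Proof.
move=> s0 sd of_ og; split=> //.
- split=> [i|i j ij]; first by case: ifP.
  case: ifP => jn; first by rewrite (leq_ltn_trans ij jn) sd.
  by case: ifP.
- apply: cvg_near_cst; near=> i; rewrite ltnNge.
  by have -> : (n <= i)%N by near: i; exact: nbhs_infty_ge.
- move=> x; apply: cvg_near_cst; near=> N.
  have nN : (n <= N)%N by near: N; exact: nbhs_infty_ge.
  rewrite /schmidt_sum (big_ord_widen N (fun k => ((s k)%:C * ip (f k) x) *: g k) nN).
  rewrite [RHS]big_mkcond /=; apply: eq_bigr => i _.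
  by case: ifP => // _; rewrite mul0r scale0r.
Unshelve. all: by end_near. Qed.

End Schmidt.

(** * Compact operators *)

Section Compact.
Variables (R : realType) (H : completeNormedModType R[i]).
Variables (dot : {dot H for Num.conj}).
Hypothesis norm_dot : forall x : H, `|x| ^+ 2 = dot x x.
Local Notation ip := (ip dot).
Local Notation hn := (hn dot).
Local Notation unit_ball := [set x : H | `|x| <= 1].

Lemma unit_ballP (x : H) : unit_ball x <-> hn x <= 1.
Proof. by rewrite /= (normE norm_dot) -(rmorph1 (real_complex R)) lecR. Qed.

Lemma precompact_sub (C K : set H) : compact K -> C `<=` K -> precompact C.
Proof.
move=> cK CK; apply: precompact_subset CK _.
by apply: compact_precompact cK; exact: norm_hausdorff.
Qed.

Lemma hn_continuous (A : H -> H) : (forall x y, hn (A x - A y) <= hn (x - y)) ->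
  continuous A.
Proof.
move=> hA x; apply/cvgrPdist_lt => e e0.
have h := @cvgr_dist_lt _ _ _ (nbhs x) _ id x cvg_id e e0.
near=> y; apply: le_lt_trans (_ : `|x - y| < e); first by rewrite !(normE norm_dot) lecR.
by near: y; exact: h.
Unshelve. all: by end_near. Qed.

Lemma compact_op_linear (a : R[i]) (A B : H -> H) :
  compact_op A -> compact_op B -> compact_op (a *: A + B).
Proof.
move=> [lA [KA AK [cA _]]] [lB [KB BK [cB _]]]; split.
  move=> c x y; rewrite -![(_ + _ : H -> H) _]/(_ *: _ + _ : H) lA lB.
  rewrite scalerDr scalerDr !scalerA (mulrC a) -!scalerA.
  by rewrite addrACA.
apply: (@precompact_sub _ ((fun p : H * H => a *: p.1 + p.2) @` (KA `*` KB))).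
  apply: continuous_compact; last exact: compact_setX.
  apply: continuous_subspaceT => p.
  by apply: cvgD; [apply: cvgZl_tmp; exact: cvg_fst|exact: cvg_snd].
move=> _ [x x1 <-]; exists (A x, B x) => //; split=> /=; [apply: AK|apply: BK].
  by exists x.
by exists x.
Qed.

Lemma compact_op_conj (A : H -> H) U V : unitary_pair dot U V ->
  compact_op A -> compact_op (V \o A \o U).
Proof.
move=> uUV [lA [KA AK [cA _]]]; have uVU := unitary_pairC uUV.
have [lU lV _ _ _] := uUV.
split; first by move=> a x y /=; rewrite lU lA lV.
apply: (@precompact_sub _ (V @` KA)).
  apply: continuous_compact => //; apply: continuous_subspaceT.
  apply: hn_continuous => x y.
  by rewrite -(linear_sub _ _ lV) (unitary_pair_hn _ uVU).
move=> _ [x x1 <-]; exists (A (U x)) => //; apply: AK; exists (U x) => //.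
by move: x1; rewrite !unit_ballP (unitary_pair_hn _ uUV).
Qed.

Definition rank1 (x y : H) : H -> H := fun z => ip x z *: y.

Lemma compact_op0 : compact_op (fun=> 0 : H).
Proof.
split; first by move=> a x y; rewrite scaler0 addr0.
apply: (@precompact_sub _ [set 0]); first exact: compact_set1.
by move=> _ [x _ <-].
Qed.

(** The image of the unit ball under a rank-one operator lies in a disc of the
    complex line of [y]; it is covered by a sum of two compact real segments. *)
Lemma real_line_compact (M : R) (y : H) : compact ((fun a : R => a%:C *: y) @` `[- M, M]).
Proof.
apply: continuous_compact; last exact: segment_compact.
apply: continuous_subspaceT => a; apply/cvgrPdist_lt => e e0.
have eE : e = (complex.Re e)%:C by rewrite RRe_real // gtr0_real.
have e1 : 0 < complex.Re e by rewrite -ltcR -eE.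
have y0 : 0 < hn y + 1 by rewrite ltr_wpDl ?hn_ge0.
have h := @cvgr_dist_lt _ _ _ (nbhs a) _ id a cvg_id _ (divr_gt0 e1 y0).
near=> t; have ht : `|a - t| < complex.Re e / (hn y + 1) by near: t; exact: h.
rewrite ltr_pdivlMr // in ht.
rewrite -scalerBl -rmorphB (normE norm_dot) eE ltcR hnZ.
have -> : cn (a - t)%:C = `|a - t|.
  by apply: complexI; rewrite cnE normc_def /= expr0n addr0 sqrtr_sqr.
by apply: le_lt_trans ht; rewrite ler_wpM2l // lerDl.
Unshelve. all: by end_near. Qed.

Lemma compact_rank1 x y : compact_op (rank1 x y).
Proof.
split.
  by move=> a u v; rewrite /rank1 ipDr ipZr scalerDl scalerA.
pose K1 := (fun a : R => a%:C *: y) @` `[- hn x, hn x].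
pose K2 := (fun a : R => a%:C *: ('i%C *: y)) @` `[- hn x, hn x].
apply: (@precompact_sub _ ((fun p : H * H => p.1 + p.2) @` (K1 `*` K2))).
  apply: continuous_compact; last by apply: compact_setX; exact: real_line_compact.
  apply: continuous_subspaceT => p.
  by apply: cvgD; [exact: cvg_fst|exact: cvg_snd].
move=> _ [u /unit_ballP u1 <-]; rewrite /rank1; set c := ip x u.
have cx : cn c <= hn x.
  apply: le_trans (cauchy_schwarz _ _ _) _.
  by rewrite ler_piMr ?hn_ge0.
have c2 : complex.Re c ^+ 2 + complex.Im c ^+ 2 <= hn x ^+ 2.
  rewrite -lecR add_Re2_Im2 -cnE -(rmorphXn (real_complex R)) lecR.
  by rewrite ler_pXn2r ?nnegrE ?cn_ge0 ?hn_ge0.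
exists ((complex.Re c)%:C *: y, (complex.Im c)%:C *: ('i%C *: y)) => /=.
  have x0 := hn_ge0 dot x.
  have re2 := sqr_ge0 (complex.Re c); have im2 := sqr_ge0 (complex.Im c).
  split; [exists (complex.Re c)|exists (complex.Im c)] => //=;
    rewrite in_itv /= -ler_norml -(@ler_pXn2r _ 2) ?nnegrE //;
    rewrite real_normK ?num_real //; lra.
by rewrite scalerA -scalerDl [in RHS](complexE c) mulrC.
Qed.

Lemma compact_rank1_sum (F : nat -> H * H) n :
  compact_op (fun z => \sum_(i < n) rank1 (F i).1 (F i).2 z).
Proof.
elim: n => [|n IH].
  by under eq_fun do rewrite big_ord0; exact: compact_op0.
have := compact_op_linear 1 IH (compact_rank1 (F n).1 (F n).2).
congr compact_op; apply/funext => z; rewrite big_ord_recr /=.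
by rewrite -[LHS]/(1 *: _ + _ : H) scale1r.
Qed.

End Compact.

(** * The form of a functional on a Schatten class *)

Section Dual.
Variables (R : realType) (H : completeNormedModType R[i]).
Variables (dot : {dot H for Num.conj}).
Hypothesis norm_dot : forall x : H, `|x| ^+ 2 = dot x x.
Hypothesis Hinf : infinite_dimensional H.
Local Notation ip := (ip dot).
Local Notation hn := (hn dot).
Local Notation ons := (ons dot).
Local Notation rank1 := (rank1 dot).
Local Notation schmidt_sum := (schmidt_sum dot).

Lemma op_norm_le (A : H -> H) (B : R) : linear A ->
  (forall x, hn x <= 1 -> hn (A x) <= B) -> 0 <= op_norm A <= B.
Proof.
move=> lA AB; rewrite /op_norm; set S := [set _ | _ in _].
have A0 := linear_zero lA.
have S0 : S 0 by exists 0; rewrite /= ?A0 normr0 //= ler01.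
have SB : ubound S B.
  by move=> _ [x x1 <-]; rewrite (normE norm_dot); apply: AB; exact/unit_ballP.
apply/andP; split; last by apply: ge_sup => //; exists 0.
by apply: sup_upper_bound => //; split; [exists 0|exists B].
Qed.

Lemma schmidt_sum_rank1 s f g n :
  schmidt_sum s f g n = fun z => \sum_(i < n) rank1 (f i) ((s i)%:C *: g i) z.
Proof.
by apply/funext => z; apply: eq_bigr => i _; rewrite /rank1 scalerA mulrC.
Qed.

Lemma schmidt_sum_compact s f g n : compact_op (schmidt_sum s f g n).
Proof.
rewrite schmidt_sum_rank1.
exact: (compact_rank1_sum norm_dot (fun i => (f i, (s i)%:C *: g i))).
Qed.

(** Rank-one operators and weighted sums of orthogonal projections are both
    finite Schmidt sums, whose Schatten norm this estimates for all exponents at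
    once. *)
Lemma schmidt_sum_bound (q : \bar R) s f g n : (1 <= q)%E ->
  (forall i, 0 <= s i) -> (forall i j, (i <= j)%N -> (j < n)%N -> s j <= s i) ->
  (forall N, ons f N) -> (forall N, ons g N) ->
  schatten dot q (schmidt_sum s f g n) /\
  0 <= schatten_norm dot q (schmidt_sum s f g n) <=
    if q is r%:E then (\sum_(i < n) s i `^ r) `^ r^-1 else s 0%N.
Proof.
move=> q1 s0 sd of_ og; have sch := schmidt_trunc s0 sd of_ og.
have cS := schmidt_sum_compact s f g n.
case: q q1 => [r r1|_|//].
- have r0 : 0 < r by apply: lt_le_trans ltr01 _; rewrite -lee_fin.
  rewrite {1}/schatten_norm powR_ge0.
  apply: (schmidt_schatten norm_dot r0 cS sch) => N.
  pose u i := (if (i < n)%N then s i else 0) `^ r.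
  have u0 i : 0 <= u i by rewrite powR_ge0.
  apply: le_trans (_ : \sum_(0 <= i < maxn n N) u i <= _).
    rewrite (@big_cat_nat _ _ _ N) ?leq_maxr //= big_mkord lerDl.
    by rewrite sumr_ge0.
  rewrite (@big_cat_nat _ _ _ n) ?leq_maxl //= [X in _ + X](_ : _ = 0).
    rewrite addr0 big_mkord; apply: ler_sum => i _; rewrite /u ltn_ord.
    exact: lexx.
  rewrite big_nat_cond big1 // => i /andP[/andP[ni _] _].
  by rewrite /u ltnNge ni /= powR0 // gt_eqF.
- split; first by split.
  apply: (@op_norm_le _ (s 0%N) (proj1 cS)).
  move=> x x1; apply: le_trans (schmidt_upper norm_dot (n := 0) sch _) _ => //.
  by case: ifP => _; rewrite ?mul0r // ler_piMr.
Qed.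

Lemma unit_direction (x : H) : exists u, hn u = 1 /\ x = (hn x)%:C *: u.
Proof.
have [x0|x0] := eqVneq (hn x) 0.
  have [u [u1 _]] := @fresh _ _ dot Hinf (fun=> 0) 0 (fun i j => ltac:(by [])).
  by exists u; split=> //; rewrite x0 scale0r; apply: hn_eq0 x0.
exists ((hn x)^-1%:C *: x); rewrite hnZ cnR ?invr_ge0 ?hn_ge0 // mulVf //.
by split=> //; rewrite scalerA -(rmorphM (real_complex R)) mulfV // scale1r.
Qed.

Lemma system_from (u : H) : hn u = 1 -> exists e, (forall n, ons e n) /\ e 0%N = u.
Proof.
move=> u1; have ou : ons (fun=> u) 1.
  by move=> i j; rewrite !ltnS !leqn0 => /eqP-> /eqP->; rewrite ipxx u1 expr1n.
have [e [/orthonormal_systemP oe eu _]] := extend_system Hinf (fun=> 0) ou.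
by exists e; split=> //; exact: eu.
Qed.

Lemma rank1_schatten (q : \bar R) x y : (1 <= q)%E ->
  schatten dot q (rank1 x y) /\ 0 <= schatten_norm dot q (rank1 x y) <= hn x * hn y.
Proof.
move=> q1; have [u [u1 xu]] := unit_direction x; have [v [v1 yv]] := unit_direction y.
have [f [of_ f0]] := system_from u1; have [g [og g0]] := system_from v1.
pose s (i : nat) : R := hn x * hn y.
have s0 i : 0 <= s i by rewrite mulr_ge0 ?hn_ge0.
have -> : rank1 x y = schmidt_sum s f g 1.
  apply/funext => z; rewrite /schmidt_sum big_ord1 /rank1 f0 g0.
  rewrite {1}xu {1}yv ipZl conjR scalerA; congr (_ *: _).
  by rewrite (rmorphM (real_complex R)) /=; ring.
have [sS sN] := schmidt_sum_bound (s := s) (n := 1) q1 s0 (fun i j _ _ => lexx _) of_ og.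
have /andP[n0 nN] := sN; split=> //; rewrite n0 /=; apply: le_trans nN _.
case: q q1 {sS sN n0} => [r r1|_|//]; last exact: lexx.
rewrite big_ord1 -powRrM mulfV ?powRr1 //.
by rewrite gt_eqF // (lt_le_trans ltr01) // -lee_fin.
Qed.

Section Functional.
Variables (q : \bar R) (L : (H -> H) -> R[i]^o).
Hypotheses (q1 : (1 <= q)%E) (dL : schatten_dual dot q L).

(** The trace duality would give [b x y = <x, B y>] for an operator [B]; the form
    is all that the argument uses of [B]. *)
Definition dual_form x y : R[i] := L (rank1 x y).
Local Notation b := dual_form.

Lemma dual_bound : exists2 M, 0 <= M &
  forall A B, schatten dot q A -> 0 <= schatten_norm dot q A <= B -> cn (L A) <= M * B.
Proof.
case: dL => _ [M LM]; exists `|M| => // A B sA /andP[n0 nB].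
have := LM A sA; rewrite -[X in X <= _]cnE lecR => h.
apply: le_trans h _; apply: le_trans (_ : `|M| * schatten_norm dot q A <= _).
  by rewrite ler_wpM2r // ler_norm.
by rewrite ler_wpM2l.
Qed.

Lemma dual_linear a A B : schatten dot q A -> schatten dot q B ->
  L (a *: A + B) = a * L A + L B.
Proof. by case: dL => h _; exact: h. Qed.

Lemma dual_zero : schatten dot q (fun=> 0) /\ L (fun=> 0) = 0.
Proof.
have [s0 _] := rank1_schatten 0 0 q1.
have e0 : rank1 0 0 = fun=> 0 by apply/funext => z; rewrite /rank1 scaler0.
rewrite e0 in s0; split=> //.
have := dual_linear 1 s0 s0; rewrite mul1r.
rewrite (_ : 1 *: _ + _ = fun=> 0); last first.
  by apply/funext => z; rewrite -[LHS]/(1 *: 0 + 0 : H) scaler0 addr0.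
by move/eqP; rewrite -subr_eq subrr => /eqP.
Qed.

Variables (M : R).
Hypotheses (M0 : 0 <= M) (LM : forall A B, schatten dot q A ->
  0 <= schatten_norm dot q A <= B -> cn (L A) <= M * B).

Lemma dual_form_bounded : bounded_form dot b M.
Proof.
have sr x y : schatten dot q (rank1 x y) := proj1 (rank1_schatten x y q1).
split=> //.
- move=> x a y z; rewrite /b -dual_linear //; congr L; apply/funext => u.
  by rewrite /rank1 -[RHS]/(a *: _ + _ : H) scalerDr !scalerA mulrC.
- move=> x a y z; rewrite /b -dual_linear //; congr L; apply/funext => u.
  by rewrite /rank1 -[RHS]/(a^* *: _ + _ : H) ipDl ipZl scalerDl scalerA.
- move=> x y; rewrite -mulrA; apply: LM => //.
  exact: (proj2 (rank1_schatten x y q1)).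
Qed.

Lemma dual_sum (F : nat -> H * H) n :
  (forall k, schatten dot q (fun z => \sum_(i < k) rank1 (F i).1 (F i).2 z)) ->
  L (fun z => \sum_(i < n) rank1 (F i).1 (F i).2 z) = \sum_(i < n) b (F i).1 (F i).2.
Proof.
move=> sF; elim: n => [|n IH].
  by under eq_fun do rewrite big_ord0; rewrite big_ord0; case: dual_zero.
rewrite big_ord_recr /= -IH -[X in X + _]mul1r -dual_linear //.
  congr L; apply/funext => z; rewrite big_ord_recr /=.
  by rewrite -[RHS]/(1 *: _ + _ : H) scale1r.
exact: (proj1 (rank1_schatten _ _ q1)).
Qed.

(** For [q > 1] the norm [n^(1/q)] of a sum of [n] orthogonal rank-one
    projections with unimodular weights grows slower than [n], so the diagonal
    of the form cannot stay away from [0] along an orthonormal system. *)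
Lemma diagonal_cluster0 e : (1 < q)%E -> (forall n, ons e n) ->
  forall r, 0 < r -> forall P : nat -> Prop, (\forall n \near \oo, P n) ->
  exists2 n, P n & cn (b (e n) (e n) - 0) <= r.
Proof.
move=> q2 oe r r0 P [N0 _ PN]; apply: contrapT => nP.
have big n : (N0 <= n)%N -> r < cn (b (e n) (e n)).
  move=> Nn; rewrite ltNge; apply/negP => h; apply: nP.
  by exists n; [exact: PN|rewrite subr0].
pose e' i := e (N0 + i)%N; pose z i : R[i] := b (e' i) (e' i).
have zr i : r < cn (z i) by apply: big; rewrite leq_addr.
have z0 i : cn (z i) != 0 by rewrite gt_eqF // (lt_trans r0).
pose u i : R[i] := (cn (z i))^-1%:C * (z i)^*.
have cu i : cn (u i) = 1.
  by rewrite cnM cnJ cnR ?invr_ge0 ?cn_ge0 // mulVf.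
have oe' n : ons e' n.
  by move=> i j im jm; rewrite (@oe (N0 + n)%N) ?ltn_add2l // eqn_add2l.
have og n : ons (fun i => u i *: e' i) n.
  move=> i j im jm; rewrite ipZr ipZl (@oe' n) //.
  have [->|ij] := eqVneq i j; last by rewrite !mulr0.
  by rewrite mulr1 mulrC cnK cu expr1n.
(* Rotating each diagonal value to its modulus, the functional takes a value of
   at least [n * r] on an operator whose norm is at most [n^(1/q)]. *)
have key n : n%:R * r <= M * (if q is p%:E then n%:R `^ p^-1 else 1).
  have [sS sN] := schmidt_sum_bound (s := fun=> 1) (n := n) q1 (fun=> ler01)
    (fun i j _ _ => lexx _) oe' og.
  have sk k : schatten dot q (fun x => \sum_(i < k) rank1 (e' i) (1%:C *: (u i *: e' i)) x).
    rewrite -(schmidt_sum_rank1 (fun=> 1) e' (fun i => u i *: e' i)).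
    by have [] := schmidt_sum_bound (s := fun=> 1) (n := k) q1 (fun=> ler01)
      (fun i j _ _ => lexx _) oe' og.
  have LS : L (schmidt_sum (fun=> 1) e' (fun i => u i *: e' i) n) =
      \sum_(i < n) (cn (z i))%:C.
    rewrite schmidt_sum_rank1.
    rewrite (@dual_sum (fun i => (e' i, 1%:C *: (u i *: e' i))) n sk) /=.
    apply: eq_bigr => i _.
    rewrite !(formZr dual_form_bounded) mul1r /u -/(z i) -mulrA cnK.
    by rewrite -(rmorphM (real_complex R)) expr2 mulKf.
  have LSn : cn (L (schmidt_sum (fun=> 1) e' (fun i => u i *: e' i) n)) =
      \sum_(i < n) cn (z i).
    rewrite LS -(rmorph_sum (real_complex R)) cnR // sumr_ge0 // => i _.
    exact: cn_ge0.
  apply: le_trans (_ : \sum_(i < n) cn (z i) <= _).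
    rewrite mulr_natl -[X in _ *+ X]card_ord -sumr_const.
    by apply: ler_sum => i _; exact: ltW.
  rewrite -LSn; apply: LM => //.
  case: q sN {sS sk} => [p| |] //.
  by under eq_bigr => i _ do rewrite powR1; rewrite sumr_const card_ord.
have [t [t1 tn]] : exists t : R, t < 1 /\ forall n, (0 < n)%N -> n%:R * r <= M * n%:R `^ t.
  move: q2 key; case: (q) => [p p1 key|_ key|//]; last first.
    by exists 0; split=> // n n0; rewrite powRr0.
  have {}p1 : 1 < p by rewrite -lte_fin.
  by exists p^-1; split=> //; rewrite invf_lt1 // (lt_trans ltr01).
have t0 : 0 < 1 - t by rewrite subr_gt0.
(* [x] is chosen so that [x^(1 - t)] exceeds [M / r]. *)
pose x := (M / r + 1) `^ (1 - t)^-1.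
have Mr : 0 <= M / r by rewrite divr_ge0 // ltW.
pose n := (Num.truncn x).+1.
have xn : x <= n%:R by rewrite ltW // truncnS_gt.
have n0 : 0 < n%:R :> R by rewrite ltr0n.
have nt : 0 < n%:R `^ t by rewrite powR_gt0.
have : n%:R `^ (1 - t) <= M / r.
  rewrite ler_pdivlMr // powRD; last by rewrite (gt_eqF n0) implybT.
  rewrite powRr1 // powRN mulrAC ler_pdivrMr //; exact: tn.
apply/negP; rewrite -ltNge.
apply: lt_le_trans (_ : x `^ (1 - t) <= _).
  by rewrite -powRrM mulVf ?gt_eqF // powRr1 ?addr_ge0 // ltrDl.
by apply: ge0_ler_powR; rewrite ?nnegrE ?powR_ge0 // ltW.
Qed.

End Functional.
End Dual.

(** * The trace of a Schmidt sum *)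

Section Trace.
Variables (R : realType) (H : completeNormedModType R[i]).
Variables (dot : {dot H for Num.conj}).
Hypothesis norm_dot : forall x : H, `|x| ^+ 2 = dot x x.
Hypothesis Hinf : infinite_dimensional H.
Hypothesis Hsep : separable_space H.
Local Notation ip := (ip dot).
Local Notation hn := (hn dot).
Local Notation ons := (ons dot).
Local Notation proj := (proj dot).
Local Notation schmidt := (schmidt dot).
Local Notation schmidt_sum := (schmidt_sum dot).

Lemma cvg_sumC k (u : nat -> nat -> R[i]^o) (l : nat -> R[i]^o) :
  (forall i, u i @ \oo --> l i) ->
  (fun n => \sum_(i < k) u i n) @ \oo --> (\sum_(i < k) l i : R[i]^o).
Proof.
move=> ul; elim: k => [|k IH]; apply/cvg_cnP => e e0.
  by apply: nearW => n; rewrite !big_ord0 subrr cn0.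
have e2 : 0 < e / 2 by rewrite divr_gt0.
have /cvg_cnP/(_ _ e2) h1 := IH; have /cvg_cnP/(_ _ e2) h2 := ul k.
near=> n; rewrite !big_ord_recr /= opprD addrACA.
apply: le_lt_trans (cnD _ _) _; rewrite [e]splitr ltrD //; near: n.
  exact: h1.
exact: h2.
Unshelve. all: by end_near. Qed.

Lemma orthonormal_basisP (e : nat -> H) : orthonormal_basis dot e ->
  (forall n, ons e n) /\ forall x, (fun n => proj e n x) @ \oo --> x.
Proof.
move=> [/orthonormal_systemP oe ce]; split=> // x.
rewrite (_ : (fun n => _) = series (fun n => braket dot (e n) x *: e n)) //.
by apply/funext => n; rewrite /series /= big_mkord.
Qed.

(** By [bessel2], each pair of singular vectors contributes at most its singular
    value. *)
Lemma trace_le A s f g (B : R) e K : schmidt A s f g ->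
  (forall n, \sum_(i < n) s i <= B) -> ons e K ->
  cn (\sum_(n < K) ip (e n) (A (e n))) <= B.
Proof.
move=> [[s0 sd] sl of_ og fg] sB oe.
pose tr j : R[i]^o := \sum_(n < K) ip (e n) (schmidt_sum s f g j (e n)).
have cvg_tr : tr @ \oo --> (\sum_(n < K) ip (e n) (A (e n)) : R[i]^o).
  apply: (@cvg_sumC K (fun n j => ip (e n) (schmidt_sum s f g j (e n)))
    (fun n => ip (e n) (A (e n)))) => n.
  by apply: (cvg_ipr norm_dot); exact: fg.
apply: (cn_cvg_le cvg_tr); apply: nearW => j; apply: le_trans (sB j).
have -> : tr j = \sum_(i < j) (s i)%:C * \sum_(n < K) (ip (f i) (e n) * ip (e n) (g i)).
  rewrite /tr /schmidt_sum; under eq_bigr => n _ do rewrite ip_sumr.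
  rewrite exchange_big; apply: eq_bigr => i _; rewrite mulr_sumr.
  by apply: eq_bigr => n _; rewrite ipZr mulrA.
apply: le_trans (cn_sum _ _ _) _; apply: ler_sum => i _.
rewrite cnM cnR // ler_piMr //; apply: le_trans (cn_sum _ _ _) _.
apply: le_trans (bessel2 _ _ oe) _.
by rewrite (ons_hn (@of_ i.+1)) // (ons_hn (@og i.+1)) // mulr1.
Qed.

Definition trace_sum (s : nat -> R) (f g : nat -> H) N : R[i]^o :=
  \sum_(i < N) (s i)%:C * ip (f i) (g i).

Lemma trace_finite s f g N e : orthonormal_basis dot e ->
  (fun K => \sum_(n < K) ip (e n) (schmidt_sum s f g N (e n)) : R[i]^o) @ \oo
    --> trace_sum s f g N.
Proof.
move=> /orthonormal_basisP[oe ce].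
have -> : (fun K => \sum_(n < K) ip (e n) (schmidt_sum s f g N (e n)) : R[i]^o)
  = fun K => \sum_(i < N) ip ((s i)%:C *: f i) (proj e K (g i)).
  apply/funext => K; rewrite /schmidt_sum.
  under eq_bigr => n _ do rewrite ip_sumr.
  rewrite exchange_big; apply: eq_bigr => i _; rewrite /proj ip_sumr.
  by apply: eq_bigr => n _; rewrite !ipZr ipZl conjR; ring.
rewrite /trace_sum; under eq_bigr => i _ do rewrite -conjR -ipZl.
apply: (@cvg_sumC N (fun i K => ip ((s i)%:C *: f i) (proj e K (g i)))
  (fun i => ip ((s i)%:C *: f i) (g i))) => i.
by apply: (cvg_ipr norm_dot); exact: ce.
Qed.

Variables (T : H -> H) (s : nat -> R) (f g : nat -> H) (B : R).
Hypotheses (sT : schmidt T s f g) (sB : forall n, \sum_(i < n) s i <= B).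

Let s0 i : 0 <= s i. Proof. by case: sT => [[]]. Qed.

Lemma trace_tail N (d : R) e K : (forall n, \sum_(N <= i < n) s i <= d) -> ons e K ->
  cn (\sum_(n < K) ip (e n) (T (e n))
      - \sum_(n < K) ip (e n) (schmidt_sum s f g N (e n))) <= d.
Proof.
move=> sd oe; rewrite -sumrB.
under eq_bigr => n _ do rewrite -ipBr.
apply: (trace_le (schmidt_tail norm_dot N sT)) => // n.
by rewrite sum_shift.
Qed.

(** Multiplied by a unit vector, the terms form a series of [H] dominated in norm
    by the singular values; its sum is paired with that vector again. *)
Lemma trace_sum_cvg : exists t : R[i]^o, trace_sum s f g @ \oo --> t.
Proof.
case: sT => _ _ of_ og _.
have [u [u1 _]] := @fresh _ _ dot Hinf (fun=> 0) 0 (fun i j => ltac:(by [])).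
pose a i : H := ((s i)%:C * ip (f i) (g i)) *: u.
have ca : cvg (series a @ \oo).
  apply/cauchy_cvgP/cauchy_seriesP => e e0.
  have eE : e = (complex.Re e)%:C by rewrite RRe_real // gtr0_real.
  have e1 : 0 < complex.Re e by rewrite -ltcR -eE.
  have [N hN] := small_tail s0 sB (divr_gt0 e1 (ltr0Sn _ 1)).
  exists ([set n | (N <= n)%N], [set: nat]).
    by split=> /=; [exists N|exact: filterT].
  move=> [m n] [/= Nm _]; rewrite eE (normE norm_dot) ltcR.
  apply: le_lt_trans (hn_sum _ _ _ _) _.
  apply: le_lt_trans (_ : \sum_(m <= i < n) s i < _).
    apply: ler_sum => i _; rewrite hnZ u1 mulr1 cnM cnR // ler_piMr //.
    apply: le_trans (cauchy_schwarz _ _ _) _.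
    by rewrite (ons_hn (@of_ i.+1)) // (ons_hn (@og i.+1)) // mulr1.
  have [nm|mn] := leqP n m; first by rewrite big_geq.
  have := hN n; rewrite (@big_cat_nat _ _ _ m) ?(ltnW mn) //=.
  have : 0 <= \sum_(N <= i < m) s i by rewrite sumr_ge0.
  by move: e1; lra.
exists (ip u (lim (series a @ \oo))).
have := cvg_ipr norm_dot (x := u) ca.
rewrite (_ : trace_sum s f g = fun n => ip u (series a n)) //.
apply/funext => n; rewrite /series /= big_mkord ip_sumr; apply: eq_bigr => i _.
by rewrite ipZr ipxx u1 expr1n mulr1.
Qed.

(** Both the limit of [trace_sum] and the trace along a basis differ from
    [trace_sum N] by at most the tail of the singular values: this gives the
    existence of the trace, hence the same estimate for [op_trace]. *)
Lemma trace_op_trace N (d : R) : (forall n, \sum_(N <= i < n) s i <= d) ->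
  cn (op_trace dot T - trace_sum s f g N) <= d.
Proof.
move=> sd; have [t ct] := trace_sum_cvg.
have isT : is_trace dot T t.
  move=> e be; have [oe ce] := orthonormal_basisP be; apply/cvg_cnP => r r0.
  have r3 : 0 < r / 4 by rewrite divr_gt0.
  have [m hm] := small_tail s0 sB r3.
  have /cvg_cnP/(_ _ r3)[m' _ hm'] := ct.
  pose j := maxn m m'.
  have hj n : \sum_(j <= i < n) s i <= r / 4.
    apply: le_trans (hm n); have [nj|jn] := leqP n j.
      by rewrite big_geq // sumr_ge0.
    by rewrite (@big_cat_nat _ _ _ j m n) ?leq_maxl ?(ltnW jn) //= lerDr sumr_ge0.
  have htj : cn (t - trace_sum s f g j) < r / 4 by apply: hm'; rewrite /= leq_maxr.
  have /cvg_cnP/(_ _ r3) h3 := @trace_finite s f g j e be.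
  near=> K; rewrite /series /= big_mkord.
  have hy : cn (trace_sum s f g j
      - \sum_(n < K) ip (e n) (schmidt_sum s f g j (e n))) < r / 4.
    by near: K; exact: h3.
  have hxy := trace_tail hj (@oe K).
  apply: le_lt_trans (cn_triangle (trace_sum s f g j) _ _) _.
  rewrite -/(\sum_(n < K) ip (e n) (T (e n))).
  set x := \sum_(n < K) _ in hxy *; set y := \sum_(n < K) _ in hy hxy *.
  have := cn_triangle y (trace_sum s f g j) x; rewrite (cnBC y x).
  by move: htj hy hxy; lra.
have isT' : is_trace dot T (op_trace dot T).
  by rewrite /op_trace; case: xgetP => [y _ //|/(_ t)]; case.
have [e be] := exists_basis norm_dot Hinf Hsep; have [oe ce] := orthonormal_basisP be.
have c1 := isT' _ be; have c2 := @trace_finite s f g N e be.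
apply/ler_addgt0Pr => r r0; have r2 : 0 < r / 2 by rewrite divr_gt0.
have /cvg_cnP/(_ _ r2) h1 := c1; have /cvg_cnP/(_ _ r2) h2 := c2.
have [K [hK1 hK2]] := filter_ex (filterI h1 h2).
have := trace_tail sd (@oe K); move: hK1 hK2; rewrite /series /= big_mkord.
set x := \sum_(n < K) _; set y := \sum_(n < K) _ => hx hy hxy.
apply: le_trans (cn_triangle x _ _) _.
have := cn_triangle y x (trace_sum s f g N); rewrite (cnBC y (trace_sum s f g N)).
by move: hx hy hxy; lra.
Unshelve. all: by end_near. Qed.

End Trace.

(** * Finite-rank approximation, uniformly over the unitary orbit *)

Section Approximation.
Variables (R : realType) (H : completeNormedModType R[i]).
Variables (dot : {dot H for Num.conj}).
Hypothesis norm_dot : forall x : H, `|x| ^+ 2 = dot x x.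
Hypothesis Hinf : infinite_dimensional H.
Hypothesis Hsep : separable_space H.
Local Notation ip := (ip dot).
Local Notation hn := (hn dot).
Local Notation ons := (ons dot).
Local Notation proj := (proj dot).
Local Notation rank1 := (rank1 dot).
Local Notation schmidt := (schmidt dot).
Local Notation schmidt_sum := (schmidt_sum dot).
Local Notation unitary_pair := (unitary_pair dot).

Lemma sum_mkseq (T : Type) (F : nat -> T) (G : T -> R[i]) n :
  \sum_(p <- mkseq F n) G p = \sum_(i < n) G (F i).
Proof.
by rewrite big_map -(big_mkord xpredT (fun i => G (F i))) /index_iota subn0.
Qed.

Definition finite_rank (F : nat -> H * H) n : H -> H :=
  fun z => \sum_(i < n) rank1 (F i).1 (F i).2 z.

Lemma finite_rank_conj F n U V : unitary_pair U V ->
  V \o finite_rank F n \o U = finite_rank (fun i => (V (F i).1, V (F i).2)) n.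
Proof.
move=> [lU lV adj _ _]; apply/funext => z /=; rewrite /finite_rank.
rewrite (linear_sum n (fun i => rank1 (F i).1 (F i).2 (U z)) lV).
by apply: eq_bigr => i _; rewrite /rank1 /= adj linear_scale.
Qed.

Lemma compact_sub (T : H -> H) F n : compact_op T -> compact_op (T - finite_rank F n).
Proof.
move=> cT; have := compact_op_linear (-1) (compact_rank1_sum norm_dot F n) cT.
by congr compact_op; apply/funext => z; rewrite scaleN1r addrC.
Qed.

Section Functional.
Variables (q : \bar R) (L : (H -> H) -> R[i]^o) (M : R).
Hypotheses (q1 : (1 <= q)%E) (dL : schatten_dual dot q L) (M0 : 0 <= M)
  (LM : forall A B, schatten dot q A -> 0 <= schatten_norm dot q A <= B ->
     cn (L A) <= M * B).
Local Notation b := (dual_form dot L).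

(** Conjugation by a unitary preserves the form of a finite-rank operator and the
    norm of the remainder, so the error does not depend on the point of the
    orbit. *)
Lemma approx_of_remainder (T : H -> H) F n d :
  (forall U V, unitary_pair U V ->
    forall k, schatten dot q (V \o finite_rank F k \o U)) ->
  (forall U V, unitary_pair U V -> schatten dot q (V \o (T - finite_rank F n) \o U) /\
    0 <= schatten_norm dot q (V \o (T - finite_rank F n) \o U) <= d) ->
  forall U V, unitary_pair U V ->
    cn (L (V \o T \o U) - \sum_(p <- mkseq F n) b (V p.1) (V p.2)) <= M * d.
Proof.
move=> sF sR U V uUV; have [sR1 sR2] := sR U V uUV.
have [_ lV _ _ _] := uUV.
have -> : V \o T \o U =
    1 *: (V \o finite_rank F n \o U) + (V \o (T - finite_rank F n) \o U).
  apply/funext => z; rewrite scale1r.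
  rewrite -[RHS]/(V (finite_rank F n (U z)) + V (T (U z) - finite_rank F n (U z))).
  by rewrite (linear_sub _ _ lV) addrC subrK.
rewrite (dual_linear dL) //; last exact: sF.
rewrite mul1r finite_rank_conj //.
rewrite (dual_sum norm_dot Hinf q1 dL (F := fun i => (V (F i).1, V (F i).2))); last first.
  by move=> k; have := sF U V uUV k; rewrite finite_rank_conj.
rewrite sum_mkseq addrAC subrr add0r.
exact: LM.
Qed.

(** The remainder of a truncated Schmidt decomposition has the tail of the
    singular values for singular values, and so have its unitary conjugates. *)
Lemma approx_schmidt (r : R) T s f g N (d : R) : q = r%:E -> 0 <= d ->
  compact_op T -> schmidt T s f g ->
  (forall n, \sum_(N <= i < n) s i `^ r <= d `^ r) ->
  forall U V, unitary_pair U V ->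
    cn (L (V \o T \o U)
      - \sum_(p <- mkseq (fun i => (f i, (s i)%:C *: g i)) N) b (V p.1) (V p.2)) <= M * d.
Proof.
move=> qr d0 cT sT sd; have [[s0 sdec] _ of_ og _] := sT.
have r1 : 1 <= r by rewrite -lee_fin -qr.
have r0 : 0 < r by rewrite (lt_le_trans ltr01).
have fE k : finite_rank (fun i => (f i, (s i)%:C *: g i)) k = schmidt_sum s f g k.
  by rewrite (schmidt_sum_rank1 dot).
apply: approx_of_remainder => U V uUV.
- move=> k; rewrite fE qr.
  have tru := schmidt_trunc (n := k) s0 (fun i j ij _ => sdec i j ij) of_ og.
  have sch := schmidt_conj norm_dot tru uUV.
  have [[_ _ oVf _ _] [_ _ _ oVg _]] := (sch, sch).
  have -> : V \o schmidt_sum s f g k \o U = schmidt_sum s (V \o f) (V \o g) k.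
    rewrite -fE finite_rank_conj // (schmidt_sum_rank1 dot); apply/funext => z.
    apply: eq_bigr => i _ /=; congr (rank1 _ _ z).
    by have [_ lV _ _ _] := uUV; rewrite linear_scale.
  have [] := schmidt_sum_bound norm_dot (q := r%:E) (n := k) (s := s)
    (f := V \o f) (g := V \o g) => //.
  by move=> i j ij _; exact: sdec.
- rewrite fE qr; have sch := schmidt_conj norm_dot (schmidt_tail norm_dot N sT) uUV.
  have cS : compact_op (V \o (T - schmidt_sum s f g N) \o U).
    by apply: (compact_op_conj norm_dot uUV); rewrite -fE; exact: compact_sub.
  have [|sS sN] := schmidt_schatten norm_dot r0 (B := d `^ r) cS sch.
    by move=> n; rewrite (sum_shift (fun i => s i `^ r)).
  split=> //; rewrite {1}/schatten_norm powR_ge0 /=.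
  by apply: le_trans sN _; rewrite -powRrM mulfV ?gt_eqF // powRr1.
Qed.

End Functional.

(** Approximate Riesz representation of a bounded functional by a partial sum
    of its Fourier expansion. *)
Lemma riesz_approx (l : H -> R[i]) (C : R) :
  (forall a x y, l (a *: x + y) = a * l x + l y) ->
  (forall x, cn (l x) <= C * hn x) -> forall r, 0 < r ->
  exists h, forall x, cn (l x - ip h x) <= r * hn x.
Proof.
move=> llin lC r r0; have [e be] := exists_basis norm_dot Hinf Hsep.
have [oe ce] := orthonormal_basisP be.
have C0 : 0 <= C.
  have h := le_trans (cn_ge0 _) (lC (e 0%N)).
  by rewrite (ons_hn (@oe 1)) // mulr1 in h.
have [//|||m hm] := @small_tail _ (fun i => cn (l (e i)) ^+ 2) (C ^+ 2) _ _ (r ^+ 2).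
- by move=> i; rewrite sqr_ge0.
- by move=> n; exact: (functional_bessel llin lC (@oe n)).
- by rewrite exprn_gt0.
pose h n := \sum_(i < n) (l (e i))^* *: e i.
have ih n x : ip (h n) x = l (proj e n x).
  rewrite /proj (functional_sum llin lC n (fun i => ip (e i) x)) /h ip_suml.
  by apply: eq_bigr => i _; rewrite ipZl conjCK mulrC.
exists (h m) => x; apply/ler_addgt0Pr => d d0.
have d1 : 0 < d / (C + 1) by rewrite divr_gt0 // ltr_wpDl.
have /(cvg_hnP norm_dot)/(_ _ d1) hx := ce x.
have hge : \forall n \near \oo, (m <= n)%N by exact: nbhs_infty_ge.
have [n [xn mn]] := filter_ex (filterI hx hge).
apply: le_trans (cn_triangle (ip (h n) x) _ _) _; rewrite addrC; apply: lerD; last first.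
  rewrite ih.
  have -> : l x - l (proj e n x) = l (x - proj e n x).
    by have := llin (-1) (proj e n x) x; rewrite scaleN1r mulN1r addrC => ->; rewrite addrC.
  apply: le_trans (lC _) _.
  apply: le_trans (_ : (C + 1) * hn (x - proj e n x) <= _).
    by rewrite ler_wpM2r ?hn_ge0 // lerDl.
  by rewrite mulrC -ler_pdivlMr ?ltW // ltr_wpDl.
rewrite -ipBl; apply: le_trans (cauchy_schwarz _ _ _) _.
rewrite ler_wpM2r ?hn_ge0 // -(@ler_pXn2r _ 2) ?nnegrE ?hn_ge0 ?(ltW r0) //.
apply: le_trans (hm n).
pose a i := if (m <= i)%N then (l (e i))^* else 0.
have -> : h n - h m = \sum_(i < n) a i *: e i.
  rewrite /h -!(big_mkord xpredT (fun i => (l (e i))^* *: e i)).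
  rewrite -(big_mkord xpredT (fun i => a i *: e i)) !(@big_cat_nat _ _ _ m 0 n) //=.
  rewrite [LHS]addrC addKr [X in _ = X + _]big_nat_cond [X in _ = X + _]big1 ?add0r.
    by apply: eq_big_nat => i /andP[mi _]; rewrite /a mi.
  by move=> i /andP[/andP[_ im] _]; rewrite /a leqNgt im scale0r.
rewrite (hn2_ons a (@oe n)) -(big_mkord xpredT (fun i => cn (a i) ^+ 2)).
rewrite (@big_cat_nat _ _ _ m 0 n) //= [X in X + _]big_nat_cond [X in X + _]big1 ?add0r.
  rewrite le_eqVlt; apply/orP; left; apply/eqP.
  by apply: eq_big_nat => i /andP[mi _]; rewrite /a mi cnJ.
by move=> i /andP[/andP[_ im] _]; rewrite /a leqNgt im cn0 expr0n.
Qed.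

(** The relatively compact image of the unit ball is totally bounded. *)
Lemma compact_net (T : H -> H) : compact_op T -> forall r, 0 < r ->
  exists Y : seq H, forall x, hn x <= 1 -> exists2 y, y \in Y & hn (T x - y) < r.
Proof.
move=> [lT [K TK [cK _]]] r r0.
have rC : 0 < r%:C by rewrite ltcR.
rewrite compact_cover in cK.
have [||D DK KD] := cK H K (fun y => ball y r%:C).
- by move=> y _; apply: ball_open.
- by move=> y Ky; exists y => //; apply: ballxx.
exists (finmap.enum_fset D) => x x1.
have KTx : K (T x) by apply: TK; exists x => //; exact/(unit_ballP norm_dot).
have [y yD] := KD _ KTx.
rewrite -ball_normE /ball_ /= (normE norm_dot) ltcR hnBC => h.
by exists y.
Qed.

(** Project on the span of a net of the image of the unit ball, then represent
    the coordinates of the projection by vectors. *)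
Lemma compact_approx (T : H -> H) : compact_op T -> forall r, 0 < r ->
  exists F n, forall x, hn x <= 1 -> hn (T x - finite_rank F n x) <= r.
Proof.
move=> cT r r0; have r2 : 0 < r / 2 by rewrite divr_gt0.
have [Y hY] := compact_net cT r2; have [lT _] := cT.
have [f [n [of_ fY]]] := capture dot Y.
pose C := \sum_(y <- Y) hn y + r.
have C0 : 0 <= C by rewrite addr_ge0 ?(ltW r0) // sumr_ge0 // => y _; rewrite hn_ge0.
have TC1 x : hn x <= 1 -> hn (T x) <= C.
  move=> /hY[y yY Ty]; have yS : hn y <= \sum_(y <- Y) hn y.
    by rewrite (big_rem y) //= lerDl sumr_ge0 // => z _; rewrite hn_ge0.
  have := hnD dot (T x - y) y; rewrite subrK /C.
  by move: Ty r0 yS; lra.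
have TC x : hn (T x) <= C * hn x.
  have [u [u1 xu]] := unit_direction dot Hinf x.
  rewrite {1}xu linear_scale // hnZ cnR ?hn_ge0 // mulrC ler_wpM2r ?hn_ge0 //.
  by apply: TC1; rewrite u1.
have n1 : 0 < n.+1%:R :> R by rewrite ltr0n.
have step i : exists h, (i < n)%N -> forall x,
    cn (ip (f i) (T x) - ip h x) <= r / 2 / n.+1%:R * hn x.
  have [ni|_] := ltnP i n; last by exists 0.
  have [|||h hh] := @riesz_approx (fun x => ip (f i) (T x)) C _ _ (r / 2 / n.+1%:R).
  - by move=> a x y; rewrite lT ipDr ipZr.
  - move=> x; apply: le_trans (cauchy_schwarz _ _ _) _.
    by rewrite (ons_hn of_ ni) mul1r.
  - by rewrite divr_gt0.
  by exists h.
have [h hP] := choice step.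
exists (fun i => (h i, f i)), n => x x1.
have [y yY Ty] := hY _ x1.
pose D := \sum_(i < n) (ip (f i) (T x) - ip (h i) x) *: f i.
have DE : D = proj f n (T x) - finite_rank (fun i => (h i, f i)) n x.
  by rewrite -sumrB; apply: eq_bigr => i _; rewrite /rank1 scalerBl.
rewrite -[T x](subrK (proj f n (T x))) -addrA -DE.
apply: le_trans (hnD _ _ _) _; rewrite [r]splitr; apply: lerD.
  by apply: le_trans (ltW Ty); apply: proj_approx => //; exact: fY.
apply: le_trans (hn_sum _ _ _ _) _.
apply: le_trans (_ : n%:R * (r / 2 / n.+1%:R) <= _).
  apply: sum_le_ord => i; rewrite hnZ (ons_hn of_) // mulr1.
  apply: le_trans (hP i (ltn_ord i) x) _.
  by rewrite ler_piMr // ltW // divr_gt0.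
rewrite mulrCA ler_piMr ?(ltW r2) // ler_pdivrMr // mul1r ler_nat //.
Qed.

Lemma approx_compact (L : (H -> H) -> R[i]^o) (M : R) T (d : R) :
  schatten_dual dot +oo%E L -> 0 <= M ->
  (forall A B, schatten dot +oo%E A -> 0 <= schatten_norm dot +oo%E A <= B ->
     cn (L A) <= M * B) ->
  compact_op T -> 0 < d ->
  exists S : seq (H * H), forall U V, unitary_pair U V ->
    cn (L (V \o T \o U) - \sum_(p <- S) dual_form dot L (V p.1) (V p.2)) <= M * d.
Proof.
move=> dL M0 LM cT d0; have [F [n hF]] := compact_approx cT d0.
exists (mkseq F n); apply: (approx_of_remainder (leey _) dL LM) => U V uUV.
  move=> k; split=> //; apply: (compact_op_conj norm_dot uUV).
  exact: compact_rank1_sum.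
have cR : compact_op (V \o (T - finite_rank F n) \o U).
  by apply: (compact_op_conj norm_dot uUV); exact: compact_sub.
split; first by split.
apply: (op_norm_le norm_dot (proj1 cR)) => x x1 /=.
rewrite (unitary_pair_hn _ (unitary_pairC uUV)); apply: hF.
by rewrite (unitary_pair_hn _ uUV).
Qed.

End Approximation.

(** * Star-shapedness *)

Section StarShape.
Variables (R : realType) (H : completeNormedModType R[i]).
Variables (dot : {dot H for Num.conj}).
Hypothesis norm_dot : forall x : H, `|x| ^+ 2 = dot x x.
Hypothesis Hinf : infinite_dimensional H.
Hypothesis Hsep : separable_space H.
Local Notation ip := (ip dot).
Local Notation hn := (hn dot).
Local Notation ons := (ons dot).

Lemma closure_cnP (S : set R[i]^o) (z : R[i]^o) :
  closure S z <-> forall d : R, 0 < d -> exists2 y, S y & cn (z - y) < d.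
Proof.
split=> [clz d d0|h B].
  have [y [Sy]] : S `&` ball z d%:C !=set0.
    by apply: clz; apply: nbhsx_ballx; rewrite ltcR.
  rewrite -ball_normE /ball_ /= -[X in X < _]cnE ltcR => zy.
  by exists y.
move=> /nbhs_ballP[e /= e0 eB].
have eE : e = (complex.Re e)%:C by rewrite RRe_real // gtr0_real.
have e1 : 0 < complex.Re e by rewrite -ltcR -eE.
have [y Sy zy] := h _ e1; exists y; split=> //; apply: eB.
by rewrite -ball_normE /ball_ /= -[X in X < _]cnE eE ltcR.
Qed.

Lemma unitary_orbitP (T A : H -> H) : unitary_orbit dot T A <->
  exists U V, unitary_pair dot U V /\ A = V \o T \o U.
Proof.
split=> [[U [V [[lU _] [lV _] adj [VU UV] ->]]]|[U [V [uUV ->]]]].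
  by exists U, V.
have uVU := unitary_pairC uUV.
exists U, V; have [lU lV adj VU UV] := uUV; split=> //.
- by split=> //; exists 1 => x; rewrite mul1r !(normE norm_dot) (unitary_pair_hn _ uUV).
- by split=> //; exists 1 => x; rewrite mul1r !(normE norm_dot) (unitary_pair_hn _ uVU).
Qed.

(** The hypotheses isolate what both cases share: a cluster value [w] of the
    diagonal of the form, and finite-rank approximations of [T], uniform over the
    orbit, with [w] times their trace close to [z0]. *)

Section Segment.
Variables (q : \bar R) (L : (H -> H) -> R[i]^o) (M : R).
Hypotheses (q1 : (1 <= q)%E) (dL : schatten_dual dot q L) (M0 : 0 <= M)
  (LM : forall A B, schatten dot q A -> 0 <= schatten_norm dot q A <= B ->
     cn (L A) <= M * B).
Local Notation b := (dual_form dot L).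
Variables (e : nat -> H) (w z0 : R[i]^o) (T : H -> H).
Hypotheses (oe : forall n, ons e n)
  (ew : forall r, 0 < r -> forall P : nat -> Prop, (\forall n \near \oo, P n) ->
    exists2 n, P n & cn (b (e n) (e n) - w) <= r)
  (approx : forall d, 0 < d -> exists S : seq (H * H),
    (forall U V, unitary_pair dot U V ->
       cn (L (V \o T \o U) - \sum_(p <- S) b (V p.1) (V p.2)) <= d) /\
    cn (w * \sum_(p <- S) ip p.1 p.2 - z0) <= d).

(** Rotating further from a given point of the orbit moves the functional along
    the segment to [z0]. *)
Lemma orbit_segment A (t d : R) : unitary_orbit dot T A -> 0 <= t <= 1 -> 0 < d ->
  exists2 B, unitary_orbit dot T B &
    cn ((1 - t)%:C * z0 + t%:C * L A - L B) <= d.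
Proof.
move=> /unitary_orbitP[U0 [V0 [u0 ->]]] t01 d0.
have d4 : 0 < d / 4 by rewrite divr_gt0.
have [S [LS wS]] := approx d4.
have bL := dual_form_bounded norm_dot Hinf q1 dL M0 LM.
have [U [V [u1 rot]]] :=
  rotate_towards bL oe ew (map (fun p => (V0 p.1, V0 p.2)) S) t01 d4.
rewrite !big_map /= in rot.
have u01 := unitary_pair_comp u1 u0.
exists ((V \o V0) \o T \o (U0 \o U)); 
  first by apply/unitary_orbitP; exists (U0 \o U), (V \o V0).
have h1 := LS _ _ u01; have h2 := LS _ _ u0.
have ipE : \sum_(p <- S) ip (V0 p.1) (V0 p.2) = \sum_(p <- S) ip p.1 p.2.
  by apply: eq_bigr => p _; exact: (unitary_pair_ip _ _ u0).
rewrite ipE in rot.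
set X := L (_ \o _ \o (U0 \o U)) in h1 *; set Y := L _ in h2 *.
set a := \sum_(p <- S) _ in h1 rot; set c := \sum_(p <- S) _ in h2 rot.
set tr := \sum_(p <- S) _ in wS rot.
have -> : (1 - t)%:C * z0 + t%:C * Y - X = t%:C * (Y - c)
    - (1 - t)%:C * (w * tr - z0) - (a - (t%:C * c + (1 - t)%:C * (w * tr))) - (X - a).
  by ring.
have /andP[t0 t1] := t01.
apply: le_trans (cnD _ _) _; rewrite cnN.
apply: le_trans (lerD (cnD _ _) (lexx _)) _; rewrite cnN.
apply: le_trans (lerD (lerD (cnD _ _) (lexx _)) (lexx _)) _; rewrite cnN.
rewrite !cnM !cnR ?subr_ge0 //.
have k1 : t * cn (Y - c) <= t * (d / 4) by rewrite ler_wpM2l.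
have k2 : (1 - t) * cn (w * tr - z0) <= (1 - t) * (d / 4) by rewrite ler_wpM2l ?subr_ge0.
have k3 : t * (d / 4) + (1 - t) * (d / 4) = d / 4 by ring.
by move: k1 k2 k3 rot h1; lra.
Qed.

Lemma star_shaped_closure : star_shaped z0 (closure (L @` unitary_orbit dot T)).
Proof.
have orbT : unitary_orbit dot T T.
  by apply/unitary_orbitP; exists id, id; split=> //; exact: unitary_pair_id.
split.
  apply/closure_cnP => d d0; have d2 : 0 < d / 2 by rewrite divr_gt0.
  have [|B oB hB] := orbit_segment (t := 0) orbT _ d2; first by rewrite lexx ler01.
  exists (L B); first by exists B.
  move: hB; rewrite subr0 rmorph1 rmorph0 mul1r mul0r addr0.
  by move: d0; lra.
move=> z t /closure_cnP clz t01; apply/closure_cnP => d d0.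
have d2 : 0 < d / 2 by rewrite divr_gt0.
have [_ [A oA <-] zA] := clz _ d2.
have d4 : 0 < d / 4 by rewrite divr_gt0.
have [B oB hB] := orbit_segment oA t01 d4; exists (L B); first by exists B.
have /andP[t0 t1] := t01.
rewrite (_ : _ - L B =
    t%:C * (z - L A) + ((1 - t)%:C * z0 + t%:C * L A - L B)); last first.
  by ring.
apply: le_lt_trans (cnD _ _) _; rewrite cnM cnR //.
have : t * cn (z - L A) <= 1 * cn (z - L A) by rewrite ler_wpM2r ?cn_ge0.
by move: hB zA d0; lra.
Qed.

End Segment.

Lemma star_shaped_gt1 (q : \bar R) T L : (1 < q)%E -> schatten dot q T ->
  schatten_dual dot q L -> star_shaped 0 (closure (L @` unitary_orbit dot T)).
Proof.
move=> q1 sT dL; have [M M0 LM] := dual_bound dL.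
have q1' := ltW q1.
have [e be] := exists_basis norm_dot Hinf Hsep; have [oe _] := orthonormal_basisP be.
apply: (star_shaped_closure q1' dL M0 LM oe (w := 0)).
  exact: (diagonal_cluster0 norm_dot Hinf q1' dL M0 LM q1 oe).
move=> d d0; have dM : 0 < d / (M + 1) by rewrite divr_gt0 // ltr_wpDl.
have Md : M * (d / (M + 1)) <= d.
  by rewrite mulrA ler_pdivrMr ?ltr_wpDl // mulrDr mulr1 mulrC lerDl ltW.
suff [S hS] : exists S : seq (H * H), forall U V, unitary_pair dot U V ->
    cn (L (V \o T \o U) - \sum_(p <- S) dual_form dot L (V p.1) (V p.2))
      <= M * (d / (M + 1)).
  exists S; split; last by rewrite mul0r subr0 cn0 ltW.
  by move=> U V uUV; apply: le_trans (hS U V uUV) Md.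
case: q q1' q1 sT dL LM => [r q1'|q1'|//] q1 sT dL LM; last first.
  by apply: (approx_compact norm_dot Hinf Hsep dL M0 LM) => //; case: sT.
have r0 : 0 < r by rewrite (lt_le_trans ltr01) // -lee_fin.
have [cT [s /is_singular_valuesP[f [g sch]] soo]] := sT.
have [N hN] := small_tail (fun i => powR_ge0 (s i) r)
  (fun n => power_sum_partial n soo) (powR_gt0 r dM).
exists (mkseq (fun i => (f i, (s i)%:C *: g i)) N).
exact: (approx_schmidt norm_dot Hinf q1' dL LM erefl (ltW dM) cT sch hN).
Qed.

Lemma star_shaped_trace T L : schatten dot 1%E T -> schatten_dual dot 1%E L ->
  forall z, [set op_trace dot T * w | w in essential_range dot L] z ->
  star_shaped z (closure (L @` unitary_orbit dot T)).
Proof.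
move=> sT dL _ [w [e /orthonormal_systemP oe ew] <-].
have [M M0 LM] := dual_bound dL.
apply: (star_shaped_closure (lexx _) dL M0 LM oe (w := w)).
  move=> r r0 P nP; have /cvg_cnP/(_ _ r0) h := ew.
  have [n [Pn hn]] := filter_ex (filterI nP h); exists n => //.
  by rewrite cnBC; exact: ltW.
move=> d d0; have [cT [s /is_singular_valuesP[f [g sch]] soo]] := sT.
have [[s0 _] _ _ _ _] := sch.
have sB n : \sum_(i < n) s i <= fine (power_sum 1 s).
  apply: le_trans (power_sum_partial n soo).
  by apply: ler_sum => i _; rewrite powRr1.
pose c := Num.min (d / (M + 1)) (d / (cn w + 1)).
have M1 : 0 < M + 1 by rewrite ltr_wpDl.
have w1 : 0 < cn w + 1 by rewrite ltr_wpDl ?cn_ge0.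
have c0 : 0 < c by rewrite lt_min !divr_gt0.
have [cM cw] : c * (M + 1) <= d /\ c * (cn w + 1) <= d.
  by rewrite -!ler_pdivlMr //; split; rewrite /c ge_min lexx ?orbT.
have [N hN] := small_tail s0 sB c0.
exists (mkseq (fun i => (f i, (s i)%:C *: g i)) N); split.
  move=> U V uUV; apply: le_trans (_ : M * c <= _); last first.
    by move: cM c0; rewrite mulrDr mulr1 mulrC; lra.
  apply: (approx_schmidt norm_dot Hinf (lexx _) dL LM erefl (ltW c0) cT sch) => // n.
  rewrite powRr1 ?(ltW c0) //; apply: le_trans (hN n).
  by apply: ler_sum => i _; rewrite powRr1.
rewrite sum_mkseq.
have -> : \sum_(i < N) ip (f i, (s i)%:C *: g i).1 (f i, (s i)%:C *: g i).2
    = trace_sum dot s f g N by apply: eq_bigr => i _; rewrite /= ipZr.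
rewrite [_ * w]mulrC -mulrBr cnM cnBC.
have := trace_op_trace norm_dot Hinf Hsep sch sB hN; set x := cn (_ - _) => hx.
apply: le_trans (_ : cn w * c <= _); first by rewrite ler_wpM2l ?cn_ge0.
by move: cw c0; rewrite mulrDr mulr1 mulrC; lra.
Qed.

End StarShape.

Theorem corollary3p7 (R : realType) (H : completeNormedModType R[i])
    (dot : {dot H for Num.conj})
    (norm_dot : forall x : H, `|x| ^+ 2 = dot x x)
    (Hinf : infinite_dimensional H) (Hsep : separable_space H) :
  (forall (q : \bar R) (T : H -> H) (L : (H -> H) -> R[i]^o),
     (1 < q)%E -> schatten dot q T -> schatten_dual dot q L ->
     star_shaped 0 (closure (L @` unitary_orbit dot T)))
  /\
  (forall (T : H -> H) (L : (H -> H) -> R[i]^o),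
     schatten dot 1%E T -> schatten_dual dot 1%E L ->
     forall z, [set op_trace dot T * w | w in essential_range dot L] z ->
     star_shaped z (closure (L @` unitary_orbit dot T))).
Proof.
by split=> [q T L|T L]; [exact: star_shaped_gt1|exact: star_shaped_trace].
Qed.
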